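(* Let $G$ be a finite soluble group and let $\Gamma=\Gamma(G)$ be its normalising graph. (i) $\Gamma$ is disconnected if and only if $G=KC$ is a Frobenius group with Frobenius kernel $K$ and Frobenius complement $C$ such that for every prime $p$ dividing $|C|$ and every prime $r$ dividing $|K|$, $p$ does not divide $r-1$. Furthermore, in this case every connected component of $\Gamma$ has diameter at most $2$. (ii) If $\Gamma$ is connected, then the diameter of $\Gamma$ is at most $6$. Moreover, there exists a finite soluble group whose normalising graph has diameter exactly $6$.
   Context: For a group $G$, the normalising graph $\Gamma(G)$ has vertex set $G\setminus\{1\}$, and two distinct vertices $x,y$ are adjacent if and only if $\langle x\rangle$ normalises $\langle y\rangle$ or $\langle y\rangle$ normalises $\langle x\rangle$. The distance $\mathrm d(x,y)$ is the length of a shortest path (infinite if none exists), and the diameter is the maximum distance between vertices. *)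

(* Defs.v *)
From mathcomp Require Import all_boot all_fingroup all_solvable.
Set Implicit Arguments. Unset Strict Implicit. Unset Printing Implicit Defensive.
Local Open Scope group_scope.

Definition nadj {gT : finGroupType} (x y : gT) : bool :=
  (x != y) && ((<[x]> \subset 'N(<[y]>)) || (<[y]> \subset 'N(<[x]>))).

Definition nwalk {gT : finGroupType} (G : {set gT}) (x y : gT) (n : nat) : Prop :=
  exists p : seq gT,
    [/\ x \in G^#, path nadj x p, all (fun z => z \in G^#) p,
        last x p = y & size p = n].

Definition ndist_le {gT : finGroupType} (G : {set gT}) (x y : gT) (n : nat) : Prop :=
  exists2 m, (m <= n)%N & nwalk G x y m.

Definition nconnected_pair {gT : finGroupType} (G : {set gT}) (x y : gT) : Prop :=
  exists n, nwalk G x y n.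

Definition nconnected {gT : finGroupType} (G : {set gT}) : Prop :=
  forall x y, x \in G^# -> y \in G^# -> nconnected_pair G x y.

Definition ndiam_le {gT : finGroupType} (G : {set gT}) (k : nat) : Prop :=
  forall x y, x \in G^# -> y \in G^# -> ndist_le G x y k.

Definition ndiam_eq {gT : finGroupType} (G : {set gT}) (k : nat) : Prop :=
  ndiam_le G k /\
  exists x y, [/\ x \in G^#, y \in G^# & ~ ndist_le G x y k.-1] /\ (0 < k)%N.

(* Main.v *)
(** Let V be a minimal normal r-subgroup of G, C = C_G(V), and call e in G \ C
"good" if it normalises <v> for some v in V^#; this depends only on the coset of
e modulo C.  Given a vertex g, take a power x of g of prime order.  If x
centralises some c in C^#, then g - x - c - v for every v in V^#; if x is good,
then g is within 2 of V^#.  Otherwise let L/C be a chief factor of G, a q-group.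
If x can be chosen of order other than q, then averaging over a Frobenius group
shows that x centralises L/C; the same holds if x is in L.  The only other case
is that of a q-element g with x not in L: then g centralises a noncyclic group
of order q^2, some element of which fixes a vector of V, so g is within 2 of V^#.

So let x centralise L/C.  If L \ C has a good element e, a lift e' of its coset
centralises x, and g - x - e' - v with v depending on e only.  If not,
C_L(x) = <t> has prime order and is normalised by g; then t centralises an
element of C^#, or G = C ><| N(<t>) and any good element of G \ C again yields a
common endpoint v.  In the remaining case no element of the complement
N = N(<t>) is good; hence N has odd order and cyclic Sylow subgroups, and its
subgroups of prime order are normal.  If one of them normalises a nontrivial
cyclic subgroup of C, all vertices are within 3 of every v in V^#; if none does,
G is a Frobenius group satisfying the arithmetic condition.

The bound 6 is attained by H ><| <n> with H a 3-group and n of order 11^2, where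
n has no fixed point on H^#, A = C_H(n^11) is nontrivial, and for some k in H no
element of A^# commutes with an element of (A^k)^#.  The vertices within 2 of n
lie in C_G(n^11), those within 2 of n^k in C_G(n^11)^k, and no edge joins these
two sets. *)

From HB Require Import structures.
Require Import Defs.
From mathcomp Require Import all_boot all_fingroup all_solvable.
From mathcomp Require Import all_algebra all_field all_character.
From mathcomp Require Import ring.
Set Implicit Arguments. Unset Strict Implicit. Unset Printing Implicit Defensive.
Import GRing.Theory.
Local Open Scope group_scope.

(** * Fixed points of coprime actions *)

(** As [y ^+ n = 1], applying [y] permutes the summands cyclically; the sum is fixed by [y] and so
    lies in ['C_V[y]]. *)
Lemma cycle_orbit_sum0 (gT : finGroupType) (V : {group gT}) (abV : abelian V)
    (y : gT) (n : nat) (u : FiniteModule.fmod_of abV) :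
  y \in 'N(V) -> y ^+ n = 1 -> 'C_V[y] = 1 ->
  (\sum_(j < n) FiniteModule.actr u (y ^+ j)%g = 0)%R.
Proof.
move=> nVy yn1 cVy; set s := (\sum_(j < n) _)%R.
have sy : FiniteModule.actr s y = s.
  case: n yn1 @s => [|n] yn1 s; first by rewrite /s !big_ord0 FiniteModule.act0r.
  rewrite /s FiniteModule.actr_sum big_ord_recr big_ord_recl addrC /=.
  rewrite -FiniteModule.actrM ?groupX // -expgSr yn1 expg0; congr (_ + _)%R.
  by apply: eq_bigr => i _; rewrite -FiniteModule.actrM ?groupX // -expgSr.
apply: val_inj => /=; apply/set1gP; rewrite -cVy.
apply/subcent1P; split; first exact: FiniteModule.fmodP.
apply/esym/commgP/conjg_fixP.
by have := congr1 (fun w => val w) sy; rewrite FiniteModule.fmvalJ.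
Qed.

(* The subgroups <h r> cover each coset R y^j, 0 < j < #[y], exactly once, so
   summing the trivial traces of the h r and of y over v in V, written
   additively, gives #|R| v = \sum_(r in R) v^r. *)
Lemma transversal_family_cent (gT : finGroupType) (V R : {group gT})
    (y : gT) (h : gT -> gT) :
  abelian V -> R \subset 'N(V) -> y \in 'N(V) -> coprime #|V| #|R| ->
  'C_V[y] = 1 ->
  (forall r, r \in R ->
     [/\ h r \in 'N(V), h r ^+ #[y] = 1 & 'C_V[h r] = 1]) ->
  (forall j, (0 < j < #[y])%N ->
     {in R &, injective (fun r => h r ^+ j)} /\
     {in R, forall r, h r ^+ j \in R :* y ^+ j}) ->
  R \subset 'C(V).
Proof.
move=> abV nVR nVy coVR cVy hP hj.
pose act := @FiniteModule.actr gT V abV.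
have hsum u : (u *+ #|R| = \sum_(r in R) act u r)%R.
  apply/eqP; rewrite eq_sym -subr_eq0; apply/eqP.
  set n := #[y] in hP hj.
  have n_gt0 : (0 < n)%N by rewrite order_gt0.
  have E1 : (\sum_(r in R) \sum_(j < n) act u (h r ^+ j)%g = 0)%R.
    apply: big1 => r Rr; have [nh hn ch] := hP r Rr.
    exact: cycle_orbit_sum0.
  have E2 : (\sum_(r in R) \sum_(j < n) act u (r * y ^+ j)%g = 0)%R.
    apply: big1 => r Rr.
    transitivity (\sum_(j < n) act (act u r) (y ^+ j)%g)%R.
      apply: eq_bigr => j _; rewrite /act FiniteModule.actrM ?groupX //.
      exact: (subsetP nVR).
    by apply: cycle_orbit_sum0 => //; rewrite expg_order.
  transitivity (0 - 0 : FiniteModule.fmod_of abV)%R; last exact: subr0.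
  rewrite -[in X in (_ = 0 - X)%R]E1 -[in X in (_ = X - _)%R]E2.
  rewrite ![(\sum_(r in R) \sum_(j < n) _)%R]exchange_big /=.
  move: n_gt0 hj E1 E2; case: (n) => // m _ hj _ _.
  rewrite !big_ord_recl /=.
  have -> : (\sum_(i < m) \sum_(r in R) act u (h r ^+ bump 0 i)%g =
             \sum_(i < m) \sum_(r in R) act u (r * y ^+ bump 0 i)%g)%R.
    apply: eq_bigr => i _; rewrite /bump /= add1n.
    have [inj_h imh] := hj i.+1 (ltn_ord i).
    have im : R :* y ^+ i.+1 = [set h r ^+ i.+1 | r in R].
      apply/esym/eqP; rewrite eqEcard card_in_imset // card_rcoset leqnn andbT.
      by apply/subsetP => _ /imsetP[r Rr ->]; apply: imh.
    rewrite -(big_imset (fun g => act u g)) //= -im.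
    rewrite -rcosetE big_imset //=.
    by move=> a b _ _; apply: mulIg.
  rewrite opprD addrACA subrr addr0; congr (_ - _)%R.
    by apply: eq_bigr => r _; rewrite expg0 mulg1.
  rewrite (eq_bigr (fun=> u)) ?sumr_const // => r _.
  by rewrite expg0 /act FiniteModule.actr1.
apply/centsP => r Rr v Vv.
pose u := FiniteModule.fmod abV v.
(* The right side of [hsum] is [R]-invariant, so [R] fixes [v ^+ #|R|], which generates [<[v]>] by
   coprimality. *)
have fixed : (act (u *+ #|R|) r = u *+ #|R|)%R.
  rewrite hsum /act FiniteModule.actr_sum [RHS](reindex_inj (mulIg r)) /=.
  apply: eq_big => [x|x Rx]; first by rewrite groupMr.
  by rewrite FiniteModule.actrM ?(subsetP nVR).
have cr : r \in 'C[v ^+ #|R|].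
  rewrite cent1C; apply/cent1P/commgP/conjg_fixP.
  have := congr1 val fixed; rewrite /act FiniteModule.fmvalJ ?(subsetP nVR) //.
  by rewrite FiniteModule.fmvalZ FiniteModule.fmodK.
have : v \in 'C[r].
  rewrite -cycle_subG.
  have <- : <[v ^+ #|R|]> = <[v]>.
    apply/esym/eqP; rewrite -/(generator _ _) generator_coprime.
    by apply: coprime_dvdl (order_dvdG Vv) coVR.
  by rewrite cycle_subG cent1C.
by move/cent1P.
Qed.

Lemma prime_cycle_expg (gT : finGroupType) (x : gT) (j : nat) :
  prime #[x] -> (0 < j < #[x])%N -> <[x ^+ j]> = <[x]>.
Proof.
move=> px /andP[j0 jx]; apply/esym/eqP.
rewrite -/(generator _ _) generator_coprime prime_coprime //.
by apply/negP => /(dvdn_leq j0); rewrite leqNgt jx.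
Qed.

(** The family consists of the conjugates [y ^ r]. Their [j]-th powers lie in [R :* y ^+ j] because
    [y] normalises [R], and are distinct because [<[y ^+ j]> = <[y]>] has no fixed point in
    [R^#]. *)
Lemma regular_prime_cent (gT : finGroupType) (V R : {group gT}) (y : gT) :
  abelian V -> R \subset 'N(V) -> y \in 'N(V) -> y \in 'N(R) ->
  coprime #|V| #|R| -> prime #[y] -> 'C_V[y] = 1 -> 'C_R[y] = 1 ->
  R \subset 'C(V).
Proof.
move=> abV nVR nVy nRy coVR py cVy cRy.
apply: (@transversal_family_cent _ V R y (fun r => y ^ r)) => // [r Rr|j jy].
  have nVr := subsetP nVR r Rr.
  rewrite groupJ // -conjXg expg_order conj1g; split=> //.
  by rewrite -(conjs1g r) -cVy conjIg (normP nVr) -cent1J.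
split=> [r s Rr Rs | r Rr] /=; rewrite -!conjXg; last first.
  rewrite mem_rcoset; set z := y ^+ j.
  have -> : z ^ r * z^-1 = r^-1 * r ^ z^-1 by rewrite !conjgE invgK !mulgA.
  by rewrite groupM ?groupV // memJ_norm // groupV groupX.
move=> eq_rs.
suff : r * s^-1 \in 'C_R[y].
  by rewrite cRy => /set1gP/(canRL (mulgKV s)); rewrite mul1g.
rewrite inE groupM ?groupV //= cent1C.
have: r * s^-1 \in 'C(<[y ^+ j]>).
  by rewrite cent_cycle cent1C; apply/cent1P/commgP/conjg_fixP;
     rewrite conjgM eq_rs conjgK.
by rewrite (prime_cycle_expg py jy) cent_cycle cent1C.
Qed.

(** If no element of [E^#] fixed a point of [V^#], then for [y] outside [<[x]>] the elements
    [r * y], with [r] in [<[x]>], would form a transversal family, and [x] would centralise [V]. *)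
Lemma noncyclic_abelem_fix (gT : finGroupType) (V E : {group gT}) (q : nat) :
  abelian V -> V :!=: 1 -> E \subset 'N(V) -> coprime #|V| #|E| ->
  q.-abelem E -> ~~ cyclic E ->
  exists2 e, e \in E^# & 'C_V[e] != 1.
Proof.
move=> abV ntV nVE coVE abE ncE.
apply/exists_inP; apply: contraR ncE => /exists_inPn noC.
have [-> | ntE] := eqsVneq E 1; first exact: cyclic1.
have abelE := abelem_abelian abE.
have [pq _ _] := pgroup_pdiv (abelem_pgroup abE) ntE.
have oE e : e \in E^# -> #[e] = q.
  by case/setD1P=> nte Ee; apply: (abelem_order_p abE).
have [x Ex ntx] := trivgPn _ ntE.
have Ex1 : x \in E^# by rewrite !inE ntx.
apply/cyclicP; exists x; apply/eqP; rewrite eqEsubset cycle_subG Ex andbT.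
apply/subsetP => y Ey; apply: contraT => nxy.
have nty : y != 1 by apply: contraNneq nxy => ->.
have Ey1 : y \in E^# by rewrite !inE nty.
have ox := oE _ Ex1; have oy := oE _ Ey1.
have sxE : <[x]> \subset E by rewrite cycle_subG.
have: <[x]> \subset 'C(V).
  apply: (@transversal_family_cent _ V _ y (fun r => r * y)) => //.
  - exact: subset_trans nVE.
  - exact: (subsetP nVE).
  - exact: coprimegS coVE.
  - by apply/eqP; move: (noC y Ey1); rewrite negbK.
  - move=> r rx; have Er := subsetP sxE r rx.
    have Ery : r * y \in E^#.
      rewrite !inE groupM // andbT; apply: contraNneq nxy => /(canRL (mulKg r)).
      by rewrite mulg1 => ->; rewrite groupV.
    rewrite (subsetP nVE) ?groupM // oy -(oE _ Ery) expg_order; split=> //.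
    by apply/eqP; move: (noC _ Ery); rewrite negbK.
  move=> j jy; split=> [r s rx sx | r rx] /=; last first.
    rewrite expgMn ?mem_rcoset ?mulgK ?groupX //.
    by apply: (centsP abelE) => //; apply: (subsetP sxE).
  have cy z : z \in <[x]> -> commute z y.
    by move=> zx; apply: (centsP abelE) => //; apply: (subsetP sxE).
  rewrite !expgMn; [|exact: cy|exact: cy] => /mulIg.
  move=> eq_rs; apply/eqP; rewrite eq_mulgV1 -order_eq1 -dvdn1.
  have crs : commute r s^-1.
    by apply: (centsP abelE); rewrite ?groupV; apply: (subsetP sxE).
  have: coprime q j.
    rewrite prime_coprime // -oy; have /andP[j0 lt_j] := jy.
    by apply/negP => /(dvdn_leq j0); rewrite leqNgt lt_j.
  move/eqP <-; rewrite dvdn_gcd -{1}ox order_dvdG ?groupM ?groupV //=.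
  by rewrite order_dvdn expgMn // expgVn eq_rs mulgV.
move=> cx; have := noC x Ex1; rewrite negbK => /eqP cVx.
case/eqP: ntV; apply/trivgP; rewrite -cVx subsetI subxx /=.
by rewrite -cent_cycle centsC.
Qed.

(** On ['Ohm_1('Z(R))], a space over ['F_r], the matrix [A] of [y] satisfies [A ^+ r = A] because
    [p] divides [r - 1]. Its minimal polynomial thus divides [X^r - X], which splits over ['F_r], so
    [A] has an eigenvector. *)
Lemma pred_dvd_norm_cycle (gT : finGroupType) (R : {group gT}) (y : gT) (p r : nat) :
  #[y] = p -> r.-group R -> R :!=: 1 -> y \in 'N(R) -> (p %| r.-1)%N ->
  exists2 u, u \in R^# & y \in 'N(<[u]>).
Proof.
move=> oy rR ntR nRy pr1.
have [pr _ _] := pgroup_pdiv rR ntR.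
pose W := 'Ohm_1('Z(R))%G.
have ntZ : 'Z(R) != 1 by rewrite (center_nil_eq1 (pgroup_nil rR)).
have rZ : r.-group 'Z(R) := pgroupS (center_sub R) rR.
have abW : r.-abelem W by apply: Ohm1_abelem (center_abelian R).
have ntW : W :!=: 1 by rewrite Ohm1_eq1.
have sWR : W \subset R := subset_trans (Ohm_sub 1 _) (center_sub R).
have nWy : <[y]> \subset 'N(W).
  rewrite cycle_subG; apply: (subsetP _ _ nRy).
  by apply: char_norms; apply: char_trans (Ohm_char _ _) (center_char R).
pose A := abelem_repr abW ntW nWy y.
have Ar : (A ^+ r = A)%R.
  have Ap : (A ^+ p = 1)%R.
    by rewrite /A -repr_mxX ?cycle_id // -oy expg_order repr_mx1.
  have /dvdnP[k Dk] := pr1.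
  suff Am m : m = (p * k).+1 -> (A ^+ m = A)%R.
    by apply: Am; rewrite mulnC -Dk prednK ?prime_gt0.
  by move=> ->; rewrite exprS exprM Ap expr1n mulr1.
have minA : (mxminpoly A %| \prod_(c : 'F_r) ('X - c%:P))%R.
  apply: mxminpoly_min.
  rewrite -finField_genPoly rmorphB /= rmorphXn /= horner_mx_X card_Fp //.
  by rewrite Ar subrr.
have [m Dm] := dvdp_prod_XsubC minA.
have [c rc] : exists c, root (mxminpoly A) c.
  have szA := size_mxminpoly A.
  have: (1 < size (mxminpoly A))%N by rewrite szA ltnS mxminpoly_nonconstant.
  rewrite (eqp_size Dm); case: mask Dm => [|c s] Dm.
    by rewrite big_nil size_poly1.
  by move=> _; exists c; rewrite (eqp_root Dm) root_prod_XsubC mem_head.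
have /eigenvalueP[v vA ntv] : eigenvalue A c by rewrite eigenvalue_root_min.
have Wu : rVabelem abW ntW v \in W := mem_rVabelem abW ntW v.
exists (rVabelem abW ntW v).
  rewrite !inE (subsetP sWR) // andbT; apply: contraNneq ntv => u1.
  by apply/eqP/(rVabelem_inj abW ntW); rewrite u1 rVabelem0.
rewrite inE -cycleJ cycle_subG -(rVabelemJ abW ntW nWy) ?cycle_id //.
by rewrite vA rVabelemZ mem_cycle.
Qed.

Lemma pgroup_subcent_neq1 (gT : finGroupType) (H S : {group gT}) (p : nat) :
  p.-group S -> S \subset 'N(H) -> prime p -> (p %| #|H|)%N -> 'C_H(S) != 1.
Proof.
move=> pS nHS pp pH; rewrite -cardG_gt1.
have acts : [acts S, on H | 'J] by rewrite astabsJ.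
have := pgroup_fix_mod pS acts; rewrite afixJ => E.
have : (p %| #|'C_H(S)|)%N by rewrite /dvdn -E; exact: pH.
by move/(dvdn_leq (cardG_gt0 _)); apply: leq_trans; apply: prime_gt1.
Qed.

Lemma prime_regular_coprime (gT : finGroupType) (H : {group gT}) (x : gT) :
  prime #[x] -> x \in 'N(H) -> 'C_H[x] = 1 -> coprime #|H| #[x].
Proof.
move=> px nHx cHx; rewrite coprime_sym prime_coprime //; apply/negP => pH.
have: 'C_H(<[x]>) != 1.
  apply: (@pgroup_subcent_neq1 _ _ _ #[x]) => //; last by rewrite cycle_subG.
  by rewrite /pgroup -orderE pnat_id.
by rewrite cent_cycle cHx eqxx.
Qed.

(** A Sylow [r]-subgroup [R] of [K] and ['C_K(V)] together make up [K], so every fixed point of the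
    [r]-group [R] in [V] is fixed by [K]. *)
Lemma pgroup_quotient_fix (gT : finGroupType) (V K : {group gT}) (r : nat) :
  r.-group V -> V :!=: 1 -> K \subset 'N(V) -> r.-nat #|K : 'C_K(V)| ->
  'C_V(K) != 1.
Proof.
move=> rV ntV nVK iK; have [pr rdV _] := pgroup_pdiv rV ntV.
have [R sylR] := Sylow_exists r K.
have [sRK rR iR] := and3P sylR.
have defK : 'C_K(V) * R = K.
  by apply: coprime_index_mulG; rewrite ?subsetIl // (pnat_coprime iK).
have := pgroup_subcent_neq1 rR (subset_trans sRK nVK) pr rdV.
apply: subG1_contra; rewrite subsetI subsetIl centsC /=.
suff: 'C_K(V) * R \subset 'C('C_V(R)) by rewrite defK.
rewrite mulG_subG; apply/andP; split; last by rewrite centsC subsetIr.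
by apply: subset_trans (subsetIr _ _) (centS (subsetIl _ _)).
Qed.

(** * Walks and distances in the normalising graph *)

Lemma ndist_refl (gT : finGroupType) (G : {group gT}) (x : gT) :
  x \in G^# -> ndist_le G x x 0.
Proof. by move=> Gx; exists 0 => //; exists [::]. Qed.

Lemma ndist_leW (gT : finGroupType) (G : {group gT}) (x y : gT) (m n : nat) :
  (m <= n)%N -> ndist_le G x y m -> ndist_le G x y n.
Proof. by move=> mn [k km W]; exists k => //; apply: leq_trans mn. Qed.

(** The case [x = y], where [nadj] fails, is covered by the empty walk; the other orientation comes
    from [ndist_sym]. *)
Lemma ndist_step (gT : finGroupType) (G : {group gT}) (x y : gT) :
  x \in G^# -> y \in G^# -> x \in 'N(<[y]>) -> ndist_le G x y 1.
Proof.
move=> Gx Gy nyx; have [-> | neq] := eqVneq x y.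
  exact: ndist_leW (ndist_refl Gy).
by exists 1%N => //; exists [:: y]; split; rewrite //= ?Gy // /nadj neq cycle_subG nyx.
Qed.

Lemma ndist_sym (gT : finGroupType) (G : {group gT}) (x y : gT) (n : nat) :
  ndist_le G x y n -> ndist_le G y x n.
Proof.
case=> m mn [p [Gx pxp Gp <- szp]]; exists m => //.
have Gxp z : z \in x :: p -> z \in G^#.
  by rewrite inE => /predU1P[-> // |]; apply: (allP Gp).
exists (rev (belast x p)); split.
- exact/Gxp/mem_last.
- rewrite rev_path (eq_path (e' := nadj)) // => z t /=.
  by rewrite /nadj eq_sym orbC.
- by apply/allP => z; rewrite mem_rev => /mem_belast; apply: Gxp.
- by case: p {pxp Gp szp Gxp} => //= z p; rewrite rev_cons last_rcons.
- by rewrite size_rev size_belast.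
Qed.

Lemma ndist_trans (gT : finGroupType) (G : {group gT}) (x y z : gT) (m n : nat) :
  ndist_le G x y m -> ndist_le G y z n -> ndist_le G x z (m + n).
Proof.
case=> m' mm [p [Gx pxp Gp py sp]] [n' nn [q [Gy pyq Gq qz sq]]].
exists (m' + n')%N; first exact: leq_add.
by exists (p ++ q); split; rewrite // ?cat_path ?all_cat ?last_cat ?size_cat ?py
  ?pxp ?Gp ?sp ?sq.
Qed.

Lemma ndist_connected (gT : finGroupType) (G : {group gT}) (x y : gT) (n : nat) :
  ndist_le G x y n -> nconnected_pair G x y.
Proof. by case=> m _ W; exists m. Qed.

(** * Complements *)

Lemma ex_prime_power (gT : finGroupType) (g : gT) :
  g != 1 -> exists2 x, x \in <[g]> & prime #[x].
Proof.
move=> ntg; have [p pp pg] : exists2 p, prime p & (p %| #[g])%N.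
  by exists (pdiv #[g]); rewrite ?pdiv_dvd // pdiv_prime // order_gt1.
by have [x gx ox] := Cauchy pp pg; exists x; rewrite // ox.
Qed.

Lemma prime_order_neq1 (gT : finGroupType) (x : gT) : prime #[x] -> x != 1.
Proof. by move/prime_gt1; rewrite order_gt1. Qed.

Lemma cent1_norm_cycle (gT : finGroupType) (x y : gT) :
  x \in 'C[y] -> x \in 'N(<[y]>).
Proof. by rewrite -cent_cycle; apply/subsetP/cent_sub. Qed.

Lemma cycle_cent1 (gT : finGroupType) (x g : gT) : x \in <[g]> -> g \in 'C[x].
Proof. by case/cycleP=> i ->; rewrite cent1C groupX // cent1id. Qed.

Lemma cycle_cent1P (gT : finGroupType) (x g h : gT) :
  x \in <[g]> -> h \in 'C[g] -> h \in 'C[x].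
Proof. by rewrite cent1C => /cycleP[i ->] hg; rewrite cent1C groupX. Qed.

Lemma sdprod_cent1_compl (gT : finGroupType) (G C N : {group gT}) (x : gT) :
  C ><| N = G -> x \in N -> 'C_C[x] = 1 -> 'C_G[x] \subset N.
Proof.
move=> defG Nx cCx; have [_ _ nCN _] := sdprodP defG.
have sub : <[x]> \subset 'N(C) :&: 'N(N).
  by rewrite cycle_subG inE (subsetP nCN) // (subsetP (normG _)).
have := subcent_sdprod defG sub; rewrite !cent_cycle cCx sdprod1g => <-.
exact: subsetIl.
Qed.

(** Let [x] in [<[g]>] have prime order. If [x] centralises some [c] in [C^#], the walk is [g], [x],
    [c], [v]. Otherwise [g] lies in a conjugate of [N] by some [k], and the walk is [g], [y ^ k],
    [u ^ k], [v]. *)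
Lemma complement_ndist3 (gT : finGroupType) (G C N : {group gT}) (y u v : gT) :
  C ><| N = G -> y \in N^# -> N \subset 'N(<[y]>) ->
  u \in C^# -> y \in 'N(<[u]>) -> v \in C^# -> C \subset 'C[v] ->
  forall g, g \in G^# -> ndist_le G g v 3.
Proof.
move=> defG Ny nyN Cu nuy Cv cvC g Gg.
have [/andP[sCG nCG] sNG _ _ _] := sdprod_context defG.
have [ntg Gg'] := setD1P Gg.
have sG1 (A : {group gT}) z : A \subset G -> z \in A^# -> z \in G^#.
  by move=> sAG; apply/subsetP/setSD.
have stepv c : c \in C^# -> ndist_le G c v 1.
  move=> Cc; apply: ndist_step; [exact: (sG1 C)|exact: (sG1 C)|].
  by apply/cent1_norm_cycle/(subsetP cvC); case/setD1P: Cc.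
have [x gx px] := ex_prime_power ntg.
have Gx : x \in G^#.
  by rewrite !inE prime_order_neq1 // (subsetP _ _ gx) // cycle_subG.
have gcx := cycle_cent1 gx.
have dgx : ndist_le G g x 1 by apply: ndist_step => //; apply: cent1_norm_cycle.
have [cCx | ntc] := eqVneq 'C_C[x] 1; last first.
  have [c /setIP[Cc xc] ntc'] := trivgPn _ ntc.
  have Cc1 : c \in C^# by rewrite !inE ntc'.
  have dxc : ndist_le G x c 1.
    apply: ndist_step => //; first exact: (sG1 C).
    by apply: cent1_norm_cycle; rewrite cent1C.
  exact: (ndist_trans dgx (ndist_trans dxc (stepv c Cc1))).
have Gx' : x \in G by case/setD1P: Gx.
have coCx := prime_regular_coprime px (subsetP nCG _ Gx') cCx.
(* The order of [x] is prime to [#|C|], so a Sylow subgroup of [N] for this prime is one of [G], and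
   [x] is conjugate into [N]. The centraliser of [x], which contains [g], follows since [x] has no
   fixed point in [C^#]. *)
have [P sylP] := Sylow_exists #[x] N.
have sylPG : #[x].-Sylow(G) P.
  have xC : #[x]^'.-nat #|C| by rewrite p'natE // -prime_coprime // coprime_sym.
  rewrite pHallE (subset_trans (pHall_sub sylP) sNG) (card_Hall sylP).
  by rewrite -(sdprod_card defG) partnM // (part_p'nat xC) mul1n /=.
have [k Gk sxP] : exists2 k, k \in G & <[x]> \subset P :^ k.
  by apply: (Sylow_subJ sylPG); rewrite ?cycle_subG // /pgroup -orderE pnat_id.
have Nx : x ^ k^-1 \in N.
  rewrite -mem_conjg; apply: (subsetP _ x (cycle_id x)).
  by apply: subset_trans sxP _; rewrite conjSg (pHall_sub sylP).
have nCk : C :^ k^-1 = C by apply/normP; rewrite groupV (subsetP nCG).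
have cCx' : 'C_C[x ^ k^-1] = 1 by rewrite cent1J -(conjs1g k^-1) -cCx conjIg nCk.
have Ng : g ^ k^-1 \in N.
  apply: (subsetP (sdprod_cent1_compl defG Nx cCx')).
  by rewrite inE groupJ ?groupV // cent1J memJ_conjg.
have Gyk : y ^ k \in G^#.
  by rewrite memJ_norm; [exact: (sG1 N)|apply: (subsetP _ _ Gk); rewrite normsD1 ?normG].
have Cuk : u ^ k \in C^# by rewrite memJ_norm //; apply: (subsetP _ _ Gk); rewrite normsD1.
have dgy : ndist_le G g (y ^ k) 1.
  apply: ndist_step => //; rewrite -[g](conjgKV k) cycleJ normJ memJ_conjg.
  exact: (subsetP nyN).
have dyu : ndist_le G (y ^ k) (u ^ k) 1.
  by apply: ndist_step => //; [exact: (sG1 C)|rewrite cycleJ normJ memJ_conjg].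
exact: (ndist_trans dgy (ndist_trans dyu (stepv _ Cuk))).
Qed.

(** Descent along the derived series of [C]: if
    [C^](n.+1)[lies in]'F(N)[, it is centralised by]C^[(n)], which is then a normal subgroup of
    class at most 2 and lies in ['F(N)] too. *)
Lemma subcent_Fitting_sub (gT : finGroupType) (N : {group gT}) :
  solvable N -> 'C_N('F(N)) \subset 'F(N).
Proof.
move=> solN; set C := 'C_N('F(N)).
have sCN : C \subset N := subsetIl _ _.
have nCN : C <| N by rewrite /normal sCN normsI ?normG ?norms_cent ?gFnorm.
have step n : C^`(n.+1) \subset 'F(N) -> C^`(n) \subset 'F(N).
  move=> sF; apply: Fitting_max; first exact: char_normal_trans (der_char n _) nCN.
  apply/lcnP; exists 2; rewrite lcnSn lcn2; apply/commG1P.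
  apply: subset_trans sF _; rewrite centsC.
  by apply: subset_trans (der_sub n _) (subsetIr _ _).
have [n sn] : exists n, C^`(n) \subset 'F(N).
  have /derivedP[n sn] := solvableS sCN solN.
  by exists n; rewrite sn sub1G.
by elim: n sn => [|n IHn /step].
Qed.


(** The element [y] centralises ['F(N)], hence belongs to it, and [<[y]>] is then characteristic in
    a cyclic Sylow subgroup of ['F(N)]. *)
Lemma regular_compl_prime_normal (gT : finGroupType) (N V : {group gT})
    (r : nat) (y : gT) :
  solvable N -> r.-group V -> abelian V -> V :!=: 1 -> N \subset 'N(V) ->
  (forall n v, n \in N^# -> v \in V^# -> n \notin 'N(<[v]>)) ->
  y \in N -> prime #[y] -> N \subset 'N(<[y]>).
Proof.
move=> solN rV abV ntV nVN noeig Ny py.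
have [pr rdV _] := pgroup_pdiv rV ntV.
have cVN n : n \in N^# -> 'C_V[n] = 1.
  move=> Nn; apply/trivgP/subsetP => v /setIP[Vv nv]; rewrite inE.
  apply: contraT => ntv; have Vv1 : v \in V^# by rewrite !inE ntv.
  by case/negP: (noeig n v Nn Vv1); rewrite cent1_norm_cycle // cent1C.
have coVN : coprime #|V| #|N|.
  rewrite (pnat_coprime rV) // p'natE //; apply/negP => rN.
  have [n Nn on] := Cauchy pr rN.
  have Nn1 : n \in N^# by rewrite !inE Nn -order_gt1 on prime_gt1.
  have := prime_regular_coprime _ (subsetP nVN n Nn) (cVN n Nn1).
  rewrite on => /(_ pr); rewrite coprime_sym prime_coprime // rdV.
  by [].
(* Here [r] would be odd, and an involution would have an eigenvector in [V] by
   [pred_dvd_norm_cycle] with [p = 2]. *)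
have oddN : odd #|N|.
  rewrite -[odd _]negbK -dvdn2; apply/negP => N2.
  have [n Nn on] := Cauchy (isT : prime 2) N2.
  have Nn1 : n \in N^# by rewrite !inE Nn -order_gt1 on.
  have r2 : (2 %| r.-1)%N.
    have [r2 | oddr] := even_prime pr.
      have : coprime #|V| 2 by apply: coprime_dvdr N2 coVN.
      by rewrite coprime_sym prime_coprime // -{1}r2 rdV.
    by rewrite dvdn2 -subn1 oddB ?prime_gt0 // oddr.
  have [v Vv nv] := pred_dvd_norm_cycle on rV ntV (subsetP nVN n Nn) r2.
  by case/negP: (noeig n v Nn1 Vv).
(* An odd [s]-group of rank at least 2 contains a noncyclic elementary abelian group, some element
   of which would fix a vector of [V]. *)
have cycN (s : nat) (S : {group gT}) : S \subset N -> s.-group S -> cyclic S.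
  move=> sSN sS; rewrite (odd_pgroup_rank1_cyclic sS) ?(oddSg sSN) //.
  rewrite leqNgt; apply/negP => /p_rank_geP[A /pnElemP[sAS abA dA]].
  have sAN := subset_trans sAS sSN.
  have [|e Ae] := noncyclic_abelem_fix abV ntV (subset_trans sAN nVN)
     (coprimegS sAN coVN) abA.
    by rewrite (abelem_cyclic abA) dA.
  by rewrite cVN ?eqxx // (subsetP (setSD _ sAN)).
have sFN : 'F(N) \subset N := Fitting_sub N.
have Fpcore (s : nat) : s.-Sylow('F(N)) 'O_s('F(N)) := nilpotent_pcore_Hall s (Fitting_nil N).
set q := #[y] in py.
have qy : q.-group <[y]> by rewrite /pgroup -orderE pnat_id.
have cyO (s : nat) : y \in 'C('O_s('F(N))).
  set S := 'O_s('F(N))%G.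
  have sSN : S \subset N := subset_trans (pcore_sub _ _) sFN.
  have nSN : N \subset 'N(S) by rewrite !gFnorm_trans ?normG.
  have nSy : y \in 'N(S) := subsetP nSN y Ny.
  have sS : s.-group S := pcore_pgroup _ _.
  have [sq | neq] := eqVneq s q.
    have nSyg : <[y]> \subset 'N(S) by rewrite cycle_subG.
    have cJ : cyclic (S <*> <[y]>).
      apply: (cycN s); rewrite ?join_subG ?sSN ?cycle_subG //.
      by rewrite /= norm_joinEr // pgroupM sS sq.
    have abJ := cyclic_abelian cJ.
    rewrite -cycle_subG centsC.
    apply: subset_trans (joing_subl _ _) (subset_trans abJ _).
    exact: centS (joing_subr _ _).
  have abS : abelian S by apply/cyclic_abelian/(cycN s).
  have coSy : coprime #|S| #|<[y]>|.
    apply: pnat_coprime sS _; rewrite -orderE -/q.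
    apply/pnatP=> [|p pp]; rewrite ?prime_gt0 ?dvdn_prime2 // => /eqP->.
    by rewrite inE /= inE /= eq_sym.
  (* By coprime action on the abelian group [S], [y] has no fixed point in [R^#]. Hence [R]
     centralises [V], which forces [R] to be trivial. *)
  pose R := [~: S, <[y]>]%G.
  have nSyg : <[y]> \subset 'N(S) by rewrite cycle_subG.
  have sRS : R \subset S by rewrite commg_subl.
  have sRN := subset_trans sRS sSN.
  have cRy : 'C_R[y] = 1 by rewrite -cent_cycle coprime_abel_cent_TI.
  have Ny1 : y \in N^# by rewrite !inE Ny prime_order_neq1.
  have cRV : R \subset 'C(V).
    apply: (regular_prime_cent (y := y)) => //; rewrite ?cVN //.
    - exact: subset_trans nVN.
    - exact: (subsetP nVN).
    - by rewrite -cycle_subG commg_normr.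
    - exact: coprimegS coVN.
  have R1 : [~: S, <[y]>] = 1.
    apply/trivgP/subsetP => z Rz; rewrite inE; apply: contraT => ntz.
    have Nz : z \in N^# by rewrite !inE ntz (subsetP sRN).
    case/eqP: ntV; apply/trivgP; rewrite -(cVN z Nz) subsetI subxx -cent_cycle.
    by rewrite centsC cycle_subG (subsetP cRV).
  by rewrite -cycle_subG centsC; apply/commG1P.
have cyF : y \in 'C('F(N)).
  rewrite -cycle_subG centsC -(Sylow_gen 'F(N)%G) gen_subG.
  apply/bigcupsP => S /SylowP[s ps sylS].
  by rewrite (nilpotent_Hall_pcore (Fitting_nil N) sylS) centsC cycle_subG; apply: cyO.
have Fy : y \in 'F(N) by apply: (subsetP (subcent_Fitting_sub solN)); rewrite inE Ny.
have Oy : <[y]> \subset 'O_q('F(N)).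
  by rewrite (sub_normal_Hall (Fpcore q)) ?pcore_normal ?cycle_subG.
have cycO : cyclic 'O_q('F(N)).
  by apply: (cycN q); rewrite ?pcore_pgroup // (subset_trans (pcore_sub _ _)).
have chy : <[y]> \char 'O_q('F(N)) by rewrite sub_cyclic_char.
apply: char_norm (char_trans chy _).
exact: char_trans (pcore_char q _) (Fitting_char N).
Qed.

Lemma special_dichotomy (gT : finGroupType) (G V C N : {group gT}) (r : nat) :
  solvable G -> r.-group V -> V :!=: 1 -> V \subset C -> C \subset 'C(V) ->
  G \subset 'N(V) -> C ><| N = G -> N :!=: 1 ->
  (forall n v, n \in N^# -> v \in V^# -> n \notin 'N(<[v]>)) ->
  ([Frobenius G = C ><| N] /\
   (forall p s : nat, prime p -> (p %| #|N|)%N -> prime s ->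
             (s %| #|C|)%N -> ~~ (p %| s.-1)%N)) \/
  (forall g v, g \in G^# -> v \in V^# -> ndist_le G g v 3).
Proof.
move=> solG rV ntV sVC cCV nVG defG ntN noeig.
have [/andP[sCG nCG] sNG _ nCN tiCN] := sdprod_context defG.
have abV : abelian V := subset_trans sVC cCV.
have ntC : C :!=: 1 := subG1_contra sVC ntV.
have [/exists_inP[y Ny /andP[py /exists_inP[u Cu nuy]]] | noy] :=
  boolP [exists y in N, prime #[y] && [exists u in C^#, y \in 'N(<[u]>)]].
  right=> g v Gg Vv; have [ntv Vv'] := setD1P Vv.
  apply: (complement_ndist3 defG _ _ Cu nuy) => //.
  - by rewrite !inE Ny prime_order_neq1.
  - apply: (regular_compl_prime_normal _ rV abV ntV) => //.
      exact: solvableS solG.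
    exact: subset_trans nVG.
  - by rewrite !inE ntv (subsetP sVC).
  - by rewrite -cent_cycle; apply: subset_trans cCV (centS _); rewrite cycle_subG.
have noyP y u : y \in N -> prime #[y] -> u \in C^# -> y \notin 'N(<[u]>).
  move=> Ny py Cu; apply: contra noy => nuy; apply/exists_inP; exists y => //.
  by rewrite py; apply/exists_inP; exists u.
have reg y : y \in N -> prime #[y] -> 'C_C[y] = 1.
  move=> Ny py; apply/trivgP/subsetP => c /setIP[Cc yc]; rewrite inE.
  apply: contraT => ntc; have Cc1 : c \in C^# by rewrite !inE ntc.
  by case/negP: (noyP y c Ny py Cc1); rewrite cent1_norm_cycle // cent1C.
left; split.
  apply/(Frobenius_semiregularP defG ntC ntN) => n /setD1P[ntn Nn].
  have [y ny py] := ex_prime_power ntn.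
  have Ny : y \in N by apply: (subsetP _ _ ny); rewrite cycle_subG.
  apply/trivgP; rewrite -(reg y Ny py) setIS //.
  by apply/subsetP => z; apply: cycle_cent1P.
move=> p s pp pN ps sC; apply/negP => p_s1.
have [y Ny oy] := Cauchy pp pN; have py : prime #[y] by rewrite oy.
have coC := prime_regular_coprime py (subsetP nCN y Ny) (reg y Ny py).
(* The coprime action of [<[y]>] leaves a Sylow [s]-subgroup of [C] invariant, where [p] dividing
   [s - 1] would yield a normalised cyclic subgroup. *)
have [|||S sylS nSy] := @sol_coprime_Sylow_exists _ s <[y]> C.
- by rewrite abelian_sol ?cycle_abelian.
- by rewrite cycle_subG (subsetP nCN).
- exact: coC.
have ntS : S :!=: 1.
  by rewrite -cardG_gt1 (card_Hall sylS) p_part_gt1 mem_primes ps sC cardG_gt0.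
have nSy' : y \in 'N(S) by rewrite -cycle_subG.
have [u Su nuy] := pred_dvd_norm_cycle oy (pHall_pgroup sylS) ntS nSy' p_s1.
have Cu : u \in C^# by apply: subsetP Su; rewrite setSD // (pHall_sub sylS).
by case/negP: (noyP y u Ny py Cu).
Qed.

(** * Chief factors *)

(** Regularity on [C] makes the order of [x] prime to [#|C|], so fixed points of [x] in [L / C] lift
    to fixed points in [L]. *)
Lemma prime_elt_cover_quotient (gT : finGroupType) (L C : {group gT}) (x : gT) :
  C \subset L -> L \subset 'N(C) -> x \in 'N(C) -> prime #[x] -> 'C_C[x] = 1 ->
  'C_L[x] / C = 'C_(L / C)(<[x]> / C).
Proof.
move=> sCL nCL nCx px cCx.
have coC := prime_regular_coprime px nCx cCx.
rewrite -cent_cycle strongest_coprime_quotient_cent ?cycle_subG //.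
- by rewrite subIset // sCL.
- by apply: coprimeSg coC; rewrite subsetIl.
by rewrite [X in _ || X]abelian_sol ?cycle_abelian ?orbT.
Qed.

(** For an [x]-invariant Sylow [q]-subgroup [S] of [L], the group [R = [~: S, <[x]>]] has no
    nontrivial fixed point of [x], so it centralises [V] and lies in [C]. Thus [x] centralises
    [L / C], and coprime lifting finishes. *)
Lemma chief_factor_centralised (gT : finGroupType) (V C L : {group gT})
    (x : gT) (q : nat) :
  solvable L -> abelian V -> 'C_L(V) \subset C -> C \subset L ->
  L \subset 'N(C) -> L \subset 'N(V) -> q.-abelem (L / C) -> coprime #|V| q ->
  x \in 'N(C) -> x \in 'N(L) -> x \in 'N(V) -> prime #[x] -> #[x] != q ->
  'C_C[x] = 1 -> 'C_V[x] = 1 -> L \subset C * 'C_L[x].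
Proof.
move=> solL abV sCVC sCL nCL nVL abLC coVq nCx nLx nVx px neq cCx cVx.
have qLC := abelem_pgroup abLC.
have coC := prime_regular_coprime px nCx cCx.
have nLX : <[x]> \subset 'N(L) by rewrite cycle_subG.
have nCX : <[x]> \subset 'N(C) by rewrite cycle_subG.
have coL : coprime #|L| #|<[x]>|.
  rewrite -(Lagrange sCL) coprimeMl coC -card_quotient //=.
  apply: pnat_coprime qLC _; rewrite -orderE; apply/pnatP=> [|s ps].
    exact: prime_gt0.
  by rewrite dvdn_prime2 // => /eqP->; rewrite inE.
have solX : solvable <[x]> by rewrite abelian_sol ?cycle_abelian.
have [S sylS nSX] := @sol_coprime_Sylow_exists _ q _ _ solX nLX coL.
have sSL := pHall_sub sylS; have nCS := subset_trans sSL nCL.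
have coS : coprime #|S| #|<[x]>| := coprimeSg sSL coL.
have defL : C * S = L.
  have /eqP: S / C = L / C.
    apply/eqP; rewrite eqEcard quotientS //= -(part_pnat_id qLC).
    by rewrite -(card_Hall (quotient_pHall nCS sylS)).
  by move=> /eqP E; rewrite -quotientK // E quotientGK // /normal sCL.
pose R := [~: S, <[x]>]%G.
have sRS : R \subset S by rewrite commg_subl.
have abSC : abelian (S / C) := abelianS (quotientS C sSL) (abelem_abelian abLC).
have coSC : coprime #|S / C| #|<[x]> / C| by rewrite coprime_morph.
(* The image of a fixed point is trivial since [S / C] is abelian, so the fixed point lies in [C],
   where [x] is regular. *)
have cRx : 'C_R[x] = 1.
  apply/trivgP/subsetP => u /setIP[Ru xu].
  have : coset C u \in 'C_([~: S / C, <[x]> / C])(<[x]> / C).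
    apply/setIP; split; first by rewrite -quotientR //; apply: mem_quotient.
    apply: (subsetP (quotient_cent C <[x]>)); apply: mem_quotient.
    by rewrite /= cent_cycle.
  rewrite coprime_abel_cent_TI ?quotient_norms // => /set1P cu1.
  have Cu : u \in C by rewrite coset_idr // (subsetP nCS) // (subsetP sRS).
  by rewrite -cCx inE Cu.
have sRC : R \subset C.
  apply: subset_trans sCVC; rewrite subsetI (subset_trans sRS) //=.
  apply: (regular_prime_cent (y := x)) => //.
  - exact: subset_trans (subset_trans sRS sSL) nVL.
  - by rewrite -cycle_subG commg_normr.
  - apply: (coprimegS sRS).
    rewrite (card_Hall sylS) p_part coprimeXr //.
rewrite -(quotientSK _ nCL) prime_elt_cover_quotient // subsetI subxx /=.
by rewrite -defL quotientMidl quotient_cents2r.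
Qed.

Lemma chief_factor_trichotomy (gT : finGroupType) (G V C L : {group gT})
    (q : nat) (g : gT) :
  solvable G -> V \subset C -> abelian V -> V :!=: 1 -> G \subset 'N(V) ->
  'C_G(V) = C -> L <| G -> C \subset L -> ~~ (L \subset C) ->
  q.-abelem (L / C) -> coprime #|V| q -> g \in G^# ->
  [\/ exists2 v, v \in V^# & ndist_le G g v 2,
      forall v, v \in V^# -> ndist_le G g v 3 |
      exists x, [/\ x \in <[g]>, prime #[x], 'C_C[x] = 1 &
                    L \subset C * 'C_L[x]]].
Proof.
move=> solG sVC abV ntV nVG defC /andP[sLG nLG] sCL nsLC abLC coVq Gg.
have [ntg Gg'] := setD1P Gg.
have sCG : C \subset G by rewrite -defC subsetIl.
have nCG : G \subset 'N(C) by rewrite -defC normsI ?normG ?norms_cent.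
have sV1 v : v \in V^# -> v \in G^#.
  by apply: subsetP; rewrite setSD // (subset_trans sVC).
have nCL := subset_trans sLG nCG.
have qLC := abelem_pgroup abLC.
have sgG : <[g]> \subset G by rewrite cycle_subG.
(* Either [<[g]>] has an element of prime order other than [q], or [g] is a [q]-element. *)
have [x [gx px xq]] : exists x, [/\ x \in <[g]>, prime #[x] &
     #[x] != q \/ q.-group <[g]>].
  have [/existsP[x /and3P[gx px neq]] | /existsPn noq] :=
    boolP [exists x, [&& x \in <[g]>, prime #[x] & #[x] != q]].
    by exists x; split=> //; left.
  have [x gx px] := ex_prime_power ntg; exists x; split=> //; right.
  apply/pgroupP => s ps sg; have [z gz oz] := Cauchy ps sg.
  by have := noq z; rewrite gz oz ps /= negbK inE.
have Gx : x \in G := subsetP sgG x gx.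
have Gx1 : x \in G^# by rewrite !inE prime_order_neq1.
have gcx := cycle_cent1 gx.
have dgx : ndist_le G g x 1 by apply: ndist_step => //; apply: cent1_norm_cycle.
have [cCx | ntc] := eqVneq 'C_C[x] 1; last first.
  have [c /setIP[Cc xc] ntc'] := trivgPn _ ntc.
  have Gc1 : c \in G^# by rewrite !inE ntc' (subsetP sCG).
  constructor 2 => v Vv; apply: ndist_trans dgx _.
  apply: (@ndist_trans _ _ _ c _ 1 1).
    by apply: ndist_step => //; apply: cent1_norm_cycle; rewrite cent1C.
  apply: ndist_step => //; first exact: sV1.
  apply: cent1_norm_cycle; move: Cc; rewrite -defC => /setIP[_].
  by apply: subsetP; rewrite -cent_cycle centS // cycle_subG; case/setD1P: Vv.
have nCx := subsetP nCG x Gx.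
have cVx : 'C_V[x] = 1 by apply/trivgP; rewrite -cCx setSI.
have [Lx | nLx] := boolP (x \in L).
  constructor 3; exists x; split=> //.
  rewrite -(quotientSK _ nCL) prime_elt_cover_quotient // subsetI subxx /=.
  apply: subset_trans (abelem_abelian abLC) (centS _).
  by rewrite quotientS // cycle_subG.
have [neq | qg] := xq.
  constructor 3; exists x; split=> //.
  apply: (chief_factor_centralised (V := V) (q := q)) => //.
  - exact: solvableS solG.
  - by rewrite -defC setSI.
  - exact: subset_trans nVG.
  - exact: (subsetP nLG).
  - exact: (subsetP nVG).
constructor 1.
have ox : #[x] = q.
  apply/eqP; rewrite -[_ == _]/(#[x] \in (q : nat_pred)).
  by apply: (pgroupP qg) => //; apply: order_dvdG.
have ntLC : (L / C)%g != 1.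
  by apply: contra nsLC => /eqP/trivgP; rewrite quotient_sub1.
have [pq qdLC _] := pgroup_pdiv qLC ntLC.
have nCg := subset_trans sgG nCG.
(* What remains is a [q]-element [g] with [x] outside [L]. As a [q]-group, [<[g]>] fixes a
   nontrivial point of [L / C]; a lift [s] of it commuting with [x] supplies the second generator of
   [E]. *)
have : 'C_(L / C)(<[g]> / C) != 1.
  apply: (pgroup_subcent_neq1 _ _ pq qdLC); first exact: quotient_pgroup.
  by rewrite quotient_norms // cycle_subG (subsetP nLG).
case/trivgPn=> sb /setIP[Lsb gsb] ntsb.
have : sb \in 'C_L[x] / C.
  rewrite prime_elt_cover_quotient // inE Lsb /=.
  by apply: subsetP gsb; rewrite centS // quotientS // cycle_subG.
case/morphimP=> s nCs /setIP[Ls xs] Dsb.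
have Gs := subsetP sLG s Ls.
have cCx1 z : z \in C -> z \in 'C[x] -> z = 1.
  by move=> Cz xz; apply/set1gP; rewrite -cCx inE Cz.
have nts : s != 1 by apply: contraNneq ntsb => s1; rewrite Dsb s1 morph1.
(* The commutator of [s] and [g] lies in [C] and commutes with [x], hence is trivial; the same
   argument gives [s ^+ q = 1]. *)
have gs : s \in 'C[g].
  apply/cent1P/commgP/eqP; apply: cCx1; last by rewrite groupR // cent1C.
  apply: coset_idr; first by rewrite groupR // (subsetP nCG).
  rewrite morphR ?(subsetP nCG) // -Dsb; apply/eqP/commgP.
  by apply: (centP gsb); rewrite mem_quotient // cycle_id.
have os : #[s] = q.
  apply/prime_nt_dvdP => //; first by rewrite order_eq1.
  rewrite order_dvdn; apply/eqP; apply: cCx1; last exact: groupX.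
  apply: coset_idr; first exact: groupX.
  by rewrite morphX // -Dsb; have [_ ->] := abelemP pq abLC.
have ti : <[x]> :&: <[s]> = 1.
  apply: prime_TIg; first by rewrite -orderE.
  apply: contra nLx; rewrite cycle_subG; apply: subsetP.
  by rewrite cycle_subG.
have csx : <[s]> \subset 'C(<[x]>) by rewrite cycle_subG /= cent_cycle.
pose E := (<[x]> <*> <[s]>)%G.
have defE : <[x]> \x <[s]> = E.
  by rewrite dprodE //= cent_joinEr.
have abE : q.-abelem E.
  by rewrite (dprod_abelem q defE) !prime_abelem -?orderE ?ox ?os.
have ncE : ~~ cyclic E.
  rewrite (abelem_cyclic abE) -(dprod_card defE) -!orderE ox os.
  by rewrite mulnn pfactorK.
have sEG : E \subset G by rewrite join_subG !cycle_subG Gx.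
have coVE : coprime #|V| #|E|.
  by rewrite -(dprod_card defE) -!orderE ox os coprimeMr coVq.
(* Both generators of [E] commute with [g], so [e] does too and the walk is [g], [e], [v]. *)
have [e Ee] := noncyclic_abelem_fix abV ntV (subset_trans sEG nVG) coVE abE ncE.
case/trivgPn=> v /setIP[Vv ev] ntv.
have Vv1 : v \in V^# by rewrite !inE ntv.
have Ge1 : e \in G^# by apply: subsetP Ee; rewrite setSD.
exists v => //; apply: (@ndist_trans _ _ _ e _ 1 1).
  apply: ndist_step => //; apply: cent1_norm_cycle; rewrite cent1C.
  case/setD1P: Ee => _; apply: subsetP; rewrite join_subG !cycle_subG gs.
  by rewrite cent1C gcx.
by apply: ndist_step; [| exact: sV1 |apply: cent1_norm_cycle; rewrite cent1C].
Qed.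

(** * Common endpoints and the bound 6 *)

Lemma ndiam6_of_hub (gT : finGroupType) (G V : {group gT}) (v0 : gT) :
  abelian V -> V \subset G -> v0 \in V^# ->
  (forall g, g \in G^# ->
     [\/ exists2 v, v \in V^# & ndist_le G g v 2,
         forall v, v \in V^# -> ndist_le G g v 3 | ndist_le G g v0 3]) ->
  ndiam_le G 6.
Proof.
move=> abV sVG Vv0 hub.
have sV1 v : v \in V^# -> v \in G^# by apply: subsetP; rewrite setSD.
(* Elements of [V^#] commute, so a vertex within 2 of one of them is within 3 of all. *)
have dV v w : v \in V^# -> w \in V^# -> ndist_le G v w 1.
  move=> Vv Vw; apply: ndist_step; try exact: sV1.
  have [[_ Vv'] [_ Vw']] := (setD1P Vv, setD1P Vw).
  by apply/cent1_norm_cycle/cent1P; apply: (centsP abV).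
have join3 x y v : ndist_le G x v 3 -> ndist_le G y v 3 -> ndist_le G x y 6.
  by move=> dx dy; apply: (@ndist_trans _ _ _ v _ 3 3) => //; apply: ndist_sym.
have near x v w : v \in V^# -> w \in V^# -> ndist_le G x v 2 -> ndist_le G x w 3.
  by move=> Vv Vw dx; apply: (ndist_trans dx (dV _ _ Vv Vw)).
move=> x y Gx Gy; case: (hub x Gx) => [[v Vv dx]|dx|dx].
- case: (hub y Gy) => [[w Vw dy]|dy|dy].
  + exact: join3 (near _ _ _ Vv Vw dx) (ndist_leW _ dy).
  + exact: join3 (near _ _ _ Vv Vv0 dx) (dy _ Vv0).
  + exact: join3 (near _ _ _ Vv Vv0 dx) dy.
- case: (hub y Gy) => [[w Vw dy]|dy|dy].
  + exact: join3 (dx _ Vw) (ndist_leW _ dy).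
  + exact: join3 (dx _ Vv0) (dy _ Vv0).
  + exact: join3 (dx _ Vv0) dy.
case: (hub y Gy) => [[w Vw dy]|dy|dy].
+ exact: join3 dx (near _ _ _ Vw Vv0 dy).
+ exact: join3 dx (dy _ Vv0).
exact: join3 dx dy.
Qed.

Lemma cent_factor_norm_cycle (gT : finGroupType) (V : {group gT}) (c d v : gT) :
  c \in 'C(V) -> v \in V -> c * d \in 'N(<[v]>) -> d \in 'N(<[v]>).
Proof.
move=> cV Vv; rewrite groupMl //; apply: cent1_norm_cycle.
by rewrite -cent_cycle (subsetP _ _ cV) // centS // cycle_subG.
Qed.

(** ['C_L[x]] meets [C] trivially and maps onto [L / C], so it is elementary abelian and, being
    cyclic, has prime order. If [t] is regular on [C], then [<[t]>] is a Sylow subgroup of [L], and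
    the Frattini argument gives the complement. *)
Lemma chief_complement (gT : finGroupType) (G C L : {group gT}) (x : gT) (q : nat) :
  C <| G -> L <| G -> C \subset L -> ~~ (L \subset C) -> q.-abelem (L / C) ->
  'C_C[x] = 1 -> L \subset C * 'C_L[x] -> cyclic 'C_L[x] ->
  exists2 t, 'C_L[x] = <[t]> &
    [/\ t \in L, prime #[t] & ('C_C[t] = 1 -> C ><| 'N_G(<[t]>) = G)].
Proof.
move=> /andP[sCG nCG] nLG sCL nsLC abLC cCx sLCD /cyclicP[t Dt].
have [sLG _] := andP nLG; have nCL := subset_trans sLG nCG.
have sDL : 'C_L[x] \subset L := subsetIl _ _.
have nCD : 'C_L[x] \subset 'N(C) := subset_trans sDL nCL.
have tiCD : C :&: 'C_L[x] = 1.
  by rewrite setIA (setIidPl sCL).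
have defLC : 'C_L[x] / C = L / C.
  by apply/eqP; rewrite eqEsubset quotientS //= quotientSK.
have isoD : 'C_L[x] \isog L / C.
  by rewrite -defLC quotient_isog.
have abD : q.-abelem 'C_L[x] by rewrite (isog_abelem isoD).
have ntD : 'C_L[x] != 1.
  by apply: contraNneq nsLC => D1; rewrite D1 mulg1 in sLCD.
have Lt : t \in L by rewrite -cycle_subG -Dt.
have nCt : t \in 'N(C) := subsetP nCL t Lt.
have [pq _ _] := pgroup_pdiv (abelem_pgroup abD) ntD.
have ot : #[t] = q.
  apply: (abelem_order_p abD); first by rewrite /= Dt cycle_id.
  by apply: contraNneq ntD => t1; rewrite Dt t1 cycle1.
have pt : prime #[t] by rewrite ot.
exists t => //; split=> // cCt.
have coC := prime_regular_coprime pt nCt cCt.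
have defL : C * <[t]> = L.
  by apply/eqP; rewrite -Dt eqEsubset sLCD mul_subG.
have cardL : (#|C| * #[t])%N = #|L|.
  have ti : C :&: <[t]> = 1 by rewrite -Dt.
  by rewrite -defL (TI_cardMg ti).
have sylD : #[t].-Sylow(L) <[t]>.
  have tC : #[t]^'.-nat #|C| by rewrite p'natE // -prime_coprime // coprime_sym.
  rewrite pHallE cycle_subG Lt -cardL partnM // -orderE (part_p'nat tC) mul1n /=.
  by rewrite part_pnat_id ?pnat_id.
have /= defG := Frattini_arg nLG sylD.
have stN : <[t]> \subset 'N_G(<[t]>).
  by rewrite subsetI normG cycle_subG (subsetP sLG).
rewrite sdprodE //=.
- by rewrite -[RHS]defG -defL -mulgA (mulSGid stN).
- by rewrite subIset // nCG.
(* If [c] in [C] normalises [<[t]>], the commutator of [c] and [t] lies in both [C] and [<[t]>], so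
   [c] centralises [t]. *)
rewrite setIA (setIidPl sCG); apply/trivgP/subsetP => c /setIP[Cc ntc].
rewrite -cCt inE Cc cent1C; apply/cent1P/commgP/eqP/set1gP.
rewrite -tiCD Dt inE; apply/andP; split.
  by rewrite commgEr groupM // memJ_norm ?groupV.
by rewrite commgEl groupM ?groupV ?cycle_id // memJ_norm ?cycle_id.
Qed.

Theorem solvable_frobenius_or_diam6 (gT : finGroupType) (G : {group gT}) :
  solvable G ->
  (exists K C : {group gT}, [Frobenius G = K ><| C] /\
     (forall p r : nat, prime p -> (p %| #|C|)%N -> prime r ->
        (r %| #|K|)%N -> ~~ (p %| r.-1)%N)) \/ ndiam_le G 6.
Proof.
move=> solG; have [G1 | ntG] := eqVneq (gval G) 1.
  by right=> x y; rewrite G1 !inE; case/andP=> /negP.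
have [V minV sVG] : {V : {group gT} | minnormal V G & V \subset G}.
  by apply: mingroup_exists; rewrite ntG normG.
have [nVG ntV /is_abelemP[r pr abelV]] := minnormal_solvable minV sVG solG.
have abV := abelem_abelian abelV; have rV := abelem_pgroup abelV.
pose C := 'C_G(V)%G.
have sVC : V \subset C by rewrite subsetI sVG.
have sCG : C \subset G := subsetIl _ _.
have cCV : C \subset 'C(V) := subsetIr _ _.
have nCG : G \subset 'N(C) by rewrite normsI ?normG ?norms_cent.
have sV1 v : v \in V^# -> v \in G^# by apply: subsetP; rewrite setSD.
have [v1 Vv1 ntv1] := trivgPn _ ntV.
have V1v1 : v1 \in V^# by rewrite !inE ntv1.
have hub0 v0 := @ndiam6_of_hub _ G V v0 abV sVG.
have [sGC | nsGC] := boolP (G \subset C).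
  right; apply: (hub0 v1) => // g Gg; constructor 2 => v Vv.
  apply: (@ndist_leW _ _ _ _ 1) => //; apply: (ndist_step Gg (sV1 v Vv)).
  apply: cent1_norm_cycle; have /setD1P[_ Gg'] := Gg; have /setD1P[_ Vv'] := Vv.
  have := subsetP cCV g (subsetP sGC g Gg'); rewrite -cent_cycle.
  by apply: subsetP; rewrite centS // cycle_subG.
have solGC : solvable (G / C) := quotient_sol _ solG.
have ntGC : (G / C)%g != 1.
  by apply: contra nsGC => /eqP/trivgP; rewrite quotient_sub1.
have [T minT sTG] : {T : {group coset_of C} | minnormal T (G / C) & T \subset G / C}.
  by apply: mingroup_exists; rewrite ntGC normG.
have [nTG ntT /is_abelemP[q pq abelT]] := minnormal_solvable minT sTG solGC.
have nsCG : C <| G by rewrite /normal sCG.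
have nsTG : T <| G / C by rewrite /normal sTG.
have [L defT sCL nsLG] := inv_quotientN nsCG nsTG.
have sLG := normal_sub nsLG.
have nCL := subset_trans sLG nCG.
have abLC : q.-abelem (L / C) by rewrite -defT.
have ntLC : ~~ (L \subset C).
  by apply: contra ntT; rewrite defT -quotient_sub1 // => /trivgP->.
(* If [q = r], then [L] acts on [V] as an [r]-group and has nontrivial fixed points; by minimality
   of [V] it centralises [V], so that [L] lies in [C]. *)
have coVq : coprime #|V| q.
  rewrite (pnat_coprime rV) // p'natE // dvdn_prime2 //; apply/eqP => qr.
  have CLV : 'C_L(V) = C.
    by apply/eqP; rewrite eqEsubset setSI //= subsetI sCL.
  have iL : r.-nat #|L : 'C_L(V)|.
    by rewrite CLV -card_quotient // qr; apply: abelem_pgroup abLC.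
  have ntCV := pgroup_quotient_fix rV ntV (subset_trans sLG nVG) iL.
  have [_ minVP] := mingroupP minV.
  have E : 'C_V(L) = V.
    apply: minVP; last exact: subsetIl.
    by rewrite ntCV normsI // norms_cent ?normal_norm.
  case/negP: ntLC; rewrite subsetI sLG centsC /=.
  have := subsetIr V 'C(L).
  by rewrite E.
have tri g := @chief_factor_trichotomy _ G V C L q g solG sVC abV ntV nVG
  (erefl _) nsLG sCL ntLC abLC coVq.
have Gprime g x : g \in G^# -> x \in <[g]> -> prime #[x] ->
    x \in G^# /\ ndist_le G g x 1.
  move=> Gg gx px; have [_ Gg'] := setD1P Gg.
  have Gx : x \in G^#.
    by rewrite !inE prime_order_neq1 // (subsetP _ _ gx) // cycle_subG.
  by split=> //; apply: ndist_step => //; apply/cent1_norm_cycle/cycle_cent1.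
have [/exists_inP[e0 /setDP[Le0 nCe0] /exists_inP[v0 Vv0 ne0]] | noeigL] :=
  boolP [exists e0 in L :\: C, exists v0 in V^#, e0 \in 'N(<[v0]>)].
  right; apply: (hub0 v0) => // g Gg.
  have [near2|far|[x [gx px cCx sL]]] := tri g Gg.
  - by constructor 1.
  - by constructor 2.
  have [Gx dgx] := Gprime g x Gg gx px.
  have /mulsgP[c d Cc /setIP[Ld xd] De0] := subsetP sL e0 Le0.
  have nd : d \in 'N(<[v0]>).
    apply: (@cent_factor_norm_cycle _ V c); rewrite -?De0 ?(subsetP cCV) //.
    by case/setD1P: Vv0.
  have Gd : d \in G^#.
    rewrite !inE (subsetP sLG) // andbT; apply: contraNneq nCe0 => d1.
    by rewrite De0 d1 mulg1.
  constructor 3; apply: (ndist_trans dgx).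
  apply: (@ndist_trans _ _ _ d _ 1 1).
    by apply: ndist_step => //; apply: cent1_norm_cycle; rewrite cent1C.
  exact: (ndist_step Gd (sV1 _ Vv0)).
have triL g : g \in G^# ->
  [\/ exists2 v, v \in V^# & ndist_le G g v 2,
      forall v, v \in V^# -> ndist_le G g v 3 |
      exists t, [/\ t \in G^#, ndist_le G g t 1 & C ><| 'N_G(<[t]>) = G]].
  move=> Gg; have [near2|far|[x [gx px cCx sL]]] := tri g Gg.
  - by constructor 1.
  - by constructor 2.
  have [Gx dgx] := Gprime g x Gg gx px.
  (* Otherwise some nontrivial element of ['C_L[x]], necessarily outside [C], fixes a vector of [V],
     against [noeigL]. *)
  have cycD : cyclic 'C_L[x].
    apply: contraT => ncD; have sDL : 'C_L[x] \subset L := subsetIl _ _.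
    have tiCD : C :&: 'C_L[x] = 1 by rewrite setIA (setIidPl sCL).
    have isoD : 'C_L[x] \isog 'C_L[x] / C.
      by rewrite quotient_isog // (subset_trans sDL).
    have abD : q.-abelem 'C_L[x].
      by rewrite (isog_abelem isoD) (abelemS _ abLC) // quotientS.
    have coD : coprime #|V| #|'C_L[x]|.
      have [k ->] := p_natP (abelem_pgroup abD); exact: coprimeXr.
    have nVD := subset_trans sDL (subset_trans sLG nVG).
    have [e /setD1P[nte De]] := noncyclic_abelem_fix abV ntV nVD coD abD ncD.
    case/trivgPn=> v /setIP[Vv ev] ntv.
    case/negP: noeigL; apply/exists_inP; exists e.
      rewrite inE (subsetP sDL) // andbT; apply: contra nte => Ce.
      by apply/eqP/set1gP; rewrite -tiCD inE Ce.
    apply/exists_inP; exists v; first by rewrite !inE ntv.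
    by rewrite cent1_norm_cycle // cent1C.
  have [t Dt [Lt pt defG]] := chief_complement nsCG nsLG sCL ntLC abLC cCx sL cycD.
  have Gt : t \in G^# by rewrite !inE prime_order_neq1 // (subsetP sLG).
  (* Since [g] commutes with [x] and normalises [L], it normalises ['C_L[x] = <[t]>]. *)
  have dgt : ndist_le G g t 1.
    apply: ndist_step => //; rewrite -Dt; have [_ Gg'] := setD1P Gg.
    rewrite (subsetP _ g (set11 g)) // normsI //.
      by rewrite sub1set (subsetP (normal_norm nsLG)).
    by rewrite sub1set (subsetP (normG _)) // cycle_cent1.
  have [cCt | ntc] := eqVneq 'C_C[t] 1.
    by constructor 3; exists t; split=> //; apply: defG.
  have [c /setIP[Cc tc] ntc'] := trivgPn _ ntc.
  have Gc : c \in G^# by rewrite !inE ntc' (subsetP sCG).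
  constructor 2 => v Vv; apply: (ndist_trans dgt).
  apply: (@ndist_trans _ _ _ c _ 1 1).
    by apply: ndist_step => //; apply: cent1_norm_cycle; rewrite cent1C.
  apply: (ndist_step Gc (sV1 v Vv)); apply: cent1_norm_cycle.
  have := subsetP cCV c Cc; rewrite -cent_cycle; apply: subsetP.
  by rewrite centS // cycle_subG; case/setD1P: Vv.
(* For a good [e0] in [G] outside [C], the [N(<[t]>)]-component [d] of [e0] is still good for [v0].
   The walk [g], [t], [d], [v0] ends at a vertex that does not depend on [g]. *)
have [/exists_inP[e0 /setDP[Ge0 nCe0] /exists_inP[v0 Vv0 ne0]] | noeig] :=
  boolP [exists e0 in G :\: C, exists v0 in V^#, e0 \in 'N(<[v0]>)].
  right; apply: (hub0 v0) => // g Gg.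
  have [near2|far|[t [Gt dgt defG]]] := triL g Gg.
  - by constructor 1.
  - by constructor 2.
  have [_ defCN _ _] := sdprodP defG.
  have : e0 \in C * 'N_G(<[t]>) by rewrite defCN.
  case/mulsgP=> c d Cc /setIP[Gd ntd] De0.
  have nd : d \in 'N(<[v0]>).
    apply: (@cent_factor_norm_cycle _ V c); rewrite -?De0 ?(subsetP cCV) //.
    by case/setD1P: Vv0.
  have Gd1 : d \in G^#.
    rewrite !inE Gd andbT; apply: contraNneq nCe0 => d1.
    by rewrite De0 d1 mulg1.
  constructor 3; apply: (ndist_trans dgt).
  apply: (@ndist_trans _ _ _ d _ 1 1); last exact: (ndist_step Gd1 (sV1 _ Vv0)).
  by apply: ndist_sym; apply: ndist_step.
have [/exists_inP[t Gt /eqP defG] | noT] :=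
  boolP [exists t in G^#, C ><| 'N_G(<[t]>) == G].
  have [_ sNG _ _ tiCN] := sdprod_context defG.
  have [|n v Nn Vv|[Frob cond]|far] :=
      special_dichotomy solG rV ntV sVC cCV nVG defG.
  - have [ntt Gt'] := setD1P Gt; apply: contraNneq ntt => N1.
    apply/eqP/set1gP; rewrite -N1 inE Gt' (subsetP (normG _)) //.
    exact: cycle_id.
  - have [ntn Nn'] := setD1P Nn; apply: contra noeig => nn.
    apply/exists_inP; exists n; last by apply/exists_inP; exists v.
    rewrite inE (subsetP sNG) // andbT; apply: contra ntn => Cn.
    by apply/eqP/set1gP; rewrite -tiCN inE Cn.
  - by left; exists C, 'N_G(<[t]>)%G.
  by right; apply: (hub0 v1) => // g Gg; constructor 2 => v; apply: far.
(* No [t] gives a complement [N(<[t]>)], so the third alternative of [triL] never occurs. *)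
right; apply: (hub0 v1) => // g Gg.
have [near2|far|[t [Gt _ defG]]] := triL g Gg.
- by constructor 1.
- by constructor 2.
by case/negP: noT; apply/exists_inP; exists t => //; apply/eqP.
Qed.

(** * Frobenius groups *)

(** Take [V] minimal normal in [G] inside [K], an [r]-group. For a prime [s] other than [r], a Sylow
    [s]-subgroup of [K] invariant under an [x] of prime order in [C] centralises [V]. Hence [K] acts
    on [V] as an [r]-group and has a nontrivial fixed point. *)
Lemma frobenius_kernel_centre (gT : finGroupType) (G K C : {group gT}) :
  solvable G -> [Frobenius G = K ><| C] ->
  exists2 z, z \in K^# & K \subset 'C[z].
Proof.
move=> solG frobG; have [defG ntK ntC _ _] := Frobenius_context frobG.
have [/andP[sKG nKG] sCG _ nKC _] := sdprod_context defG.
have regK := Frobenius_reg_ker frobG.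
have [V minV sVK] : {V : {group gT} | minnormal V G & V \subset K}.
  by apply: mingroup_exists; rewrite ntK.
have sVG := subset_trans sVK sKG.
have [nVG ntV /is_abelemP[r pr abelV]] := minnormal_solvable minV sVG solG.
have abV := abelem_abelian abelV; have rV := abelem_pgroup abelV.
have [c Cc ntc] := trivgPn _ ntC; have [x cx px] := ex_prime_power ntc.
have Cx : x \in C by apply: (subsetP _ _ cx); rewrite cycle_subG.
have Gx := subsetP sCG x Cx.
have cKx : 'C_K[x] = 1 by apply: regK; rewrite !inE prime_order_neq1.
have nKx : <[x]> \subset 'N(K) by rewrite cycle_subG (subsetP nKG).
have coKx : coprime #|K| #|<[x]>|.
  by apply: prime_regular_coprime => //; apply: (subsetP nKG).
have iK : r.-nat #|K : 'C_K(V)|.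
  apply/pnatP=> [|s ps si]; first exact: indexg_gt0.
  apply: contraLR si => neq.
  have solX : solvable <[x]> by rewrite abelian_sol ?cycle_abelian.
  have [S sylS nSx] := @sol_coprime_Sylow_exists _ s _ _ solX nKx coKx.
  have sSK := pHall_sub sylS.
  have sSC : S \subset 'C_K(V).
    rewrite subsetI sSK; apply: (regular_prime_cent (y := x)) => //.
    - exact: subset_trans sSK (subset_trans sKG nVG).
    - exact: (subsetP nVG).
    - by rewrite -cycle_subG.
    - apply: (pnat_coprime rV); apply: pi_pnat (pHall_pgroup sylS) _.
      by rewrite !inE in neq *.
    - by apply/trivgP; rewrite -cKx setSI.
    - by apply/trivgP; rewrite -cKx setSI.
  apply/negP => si; have [_ _] := and3P sylS; rewrite p'natE // => /negP[].
  by apply: dvdn_trans si _; apply: indexgS.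
have := pgroup_quotient_fix rV ntV (subset_trans sKG nVG) iK.
case/trivgPn=> z /setIP[Vz Kz] ntz; exists z.
  by rewrite !inE ntz (subsetP sVK).
by rewrite -cent_cycle centsC cycle_subG.
Qed.

(** An elementary abelian normal subgroup of [C] must be cyclic, since otherwise one of its
    nontrivial elements would have a fixed point in [K^#]. *)
Lemma frobenius_compl_normal_cycle (gT : finGroupType) (G K C : {group gT}) :
  solvable G -> [Frobenius G = K ><| C] ->
  exists2 t, t \in C^# & C \subset 'N(<[t]>).
Proof.
move=> solG frobG; have [defG ntK ntC _ _] := Frobenius_context frobG.
have [/andP[sKG nKG] sCG _ nKC _] := sdprod_context defG.
have regK := Frobenius_reg_ker frobG; have coKC := Frobenius_coprime frobG.
have nsK : K <| G by rewrite /normal sKG.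
have [V [sVK /andP[_ nVG] ntV /is_abelemP[r pr abelV]]] :=
  solvable_norm_abelem (solvableS sKG solG) nsK ntK.
have [T [sTC /andP[_ nTC] ntT /is_abelemP[q pq abelT]]] :=
  solvable_norm_abelem (solvableS sCG solG) (normal_refl C) ntC.
have coVT : coprime #|V| #|T| by apply: coprimeSg sVK (coprimegS sTC coKC).
have nVT := subset_trans sTC (subset_trans sCG nVG).
have /cyclicP[t DT] : cyclic T.
  apply: contraT => ncT.
  have [e Te] := noncyclic_abelem_fix (abelem_abelian abelV) ntV nVT coVT abelT ncT.
  have Ce : e \in C^# by apply: subsetP Te; rewrite setSD.
  case/negP; apply/eqP/trivgP; rewrite -(regK e Ce) setSI //.
exists t; last by rewrite -DT.
rewrite !inE -cycle_subG -DT sTC andbT.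
by apply: contraNneq ntT => t1; rewrite DT t1 cycle1.
Qed.

Lemma frobenius_cover (gT : finGroupType) (G K C : {group gT}) (x : gT) :
  [Frobenius G = K ><| C] -> x \in G -> x \notin K ->
  exists2 g, g \in G & x \in (C :^ g)^#.
Proof.
move=> frobG Gx nKx; have [defG _ _ _ _] := Frobenius_context frobG.
have [/andP[sKG _] _ _ _ _] := sdprod_context defG.
have := cover_partition (Frobenius_partition frobG) => covG.
have: x \in cover (gval K |: (C^# :^: K)) by rewrite covG.
case/bigcupP=> B.
rewrite !inE => /orP[/eqP-> | /imsetP[g Kg ->] xB]; first by rewrite (negPf nKx).
by exists g; [apply: (subsetP sKG) | rewrite -conjD1g].
Qed.

(** Passing to powers [x'] and [y'] of prime order, [<[y']>] would act semiregularly on [<[x']>], so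
    its order would divide that of [x'] minus 1. *)
Lemma frobenius_kernel_not_normed (gT : finGroupType) (G K C : {group gT}) (x y : gT) :
  [Frobenius G = K ><| C] ->
  (forall p r : nat, prime p -> (p %| #|C|)%N -> prime r ->
     (r %| #|K|)%N -> ~~ (p %| r.-1)%N) ->
  x \in K^# -> y \in G -> y \notin K -> y \notin 'N(<[x]>).
Proof.
move=> frobG cond /setD1P[ntx Kx] Gy nKy; apply/negP => nxy.
have [g Gg /setD1P[nty Cy]] := frobenius_cover frobG Gy nKy.
have [defG ntK ntC _ _] := Frobenius_context frobG.
have [/andP[sKG nKG] sCG _ nKC tiKC] := sdprod_context defG.
have [y' yy' py] := ex_prime_power nty; have [x' xx' px] := ex_prime_power ntx.
have Kx' : x' \in K by apply: (subsetP _ _ xx'); rewrite cycle_subG.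
have Cy' : y' \in C :^ g by apply: (subsetP _ _ yy'); rewrite cycle_subG.
have tiKCg z : z \in K -> z \in C :^ g -> z = 1.
  move=> Kz Cz; apply/set1gP; rewrite -(conjs1g g) -tiKC conjIg inE Cz andbT.
  by rewrite (normP (subsetP nKG g Gg)).
have sy'C : <[y']> \subset C :^ g by rewrite cycle_subG.
have nx'y' : <[y']> \subset 'N(<[x']>).
  rewrite cycle_subG; have: y' \in 'N(<[x]>).
    by apply: (subsetP _ _ yy'); rewrite cycle_subG.
  by apply: subsetP; rewrite char_norms // sub_cyclic_char ?cycle_cyclic ?cycle_subG.
have semi : semiregular <[x']> <[y']>.
  move=> z /setD1P[ntz y'z]; apply/trivgP/subsetP => c /setIP[x'c zc].
  rewrite inE; apply: contraT => ntc.
  have Kc : c \in K^#.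
    by rewrite !inE ntc; apply: (subsetP _ _ x'c); rewrite cycle_subG.
  case/eqP: ntz; have Cz := subsetP sy'C z y'z; apply: tiKCg => //.
  apply: (subsetP (Frobenius_cent1_ker frobG Kc)).
  rewrite inE cent1C zc andbT; move: Cz.
  by apply: subsetP; rewrite -(conjGid Gg) conjSg.
have := regular_norm_dvd_pred nx'y' semi; rewrite -!orderE.
apply/negP; apply: cond => //; last by rewrite orderE cardSg ?cycle_subG.
by rewrite -(cardJg C g) orderE cardSg.
Qed.

(** Both [x] and [x ^ y] lie in [C :^ g], and distinct conjugates of [C] meet trivially, with [C]
    its own normaliser in [G]. *)
Lemma frobenius_compl_normed (gT : finGroupType) (G K C : {group gT}) (x y g : gT) :
  [Frobenius G = K ><| C] -> g \in G -> x \in (C :^ g)^# -> y \in G ->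
  y \in 'N(<[x]>) -> y \in C :^ g.
Proof.
move=> frobG Gg /setD1P[ntx Cx] Gy nxy.
have /andP[_ /normedTI_memJ_P[_ _ memJ]] := FrobeniusWcompl frobG.
have Cxg : x ^ g^-1 \in C^#.
  by rewrite !inE conjg_eq1 ntx -mem_conjg.
rewrite mem_conjg -(memJ _ _ Cxg) ?groupJ ?groupV //.
rewrite -conjJg !inE !conjg_eq1 ntx -mem_conjg /=.
have: x ^ y \in <[x]> by rewrite memJ_norm ?cycle_id.
by apply: subsetP; rewrite cycle_subG.
Qed.

Lemma frobenius_kernel_closed (gT : finGroupType) (G K C : {group gT}) (x y : gT) :
  [Frobenius G = K ><| C] ->
  (forall p r : nat, prime p -> (p %| #|C|)%N -> prime r ->
     (r %| #|K|)%N -> ~~ (p %| r.-1)%N) ->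
  x \in K^# -> y \in G^# -> nadj x y -> y \in K^#.
Proof.
move=> frobG cond Kx /setD1P[nty Gy] /andP[_]; rewrite !cycle_subG => adj.
rewrite !inE nty; apply: contraT => nKy; have [ntx Kx'] := setD1P Kx.
have [defG _ _ _ _] := Frobenius_context frobG.
have [/andP[sKG nKG] sCG _ nKC tiKC] := sdprod_context defG.
have Gx := subsetP sKG x Kx'.
have nyx := frobenius_kernel_not_normed frobG cond Kx Gy nKy.
rewrite (negPf nyx) orbF in adj.
have [g Gg Cy] := frobenius_cover frobG Gy nKy.
have Cx := frobenius_compl_normed frobG Gg Cy Gx adj.
case/eqP: ntx; apply/set1gP; rewrite -(conjs1g g) -tiKC conjIg inE Cx andbT.
by rewrite (normP (subsetP nKG g Gg)).
Qed.

Lemma frobenius_compl_closed (gT : finGroupType) (G K C : {group gT}) (x y g : gT) :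
  [Frobenius G = K ><| C] ->
  (forall p r : nat, prime p -> (p %| #|C|)%N -> prime r ->
     (r %| #|K|)%N -> ~~ (p %| r.-1)%N) ->
  g \in G -> x \in (C :^ g)^# -> y \in G^# -> nadj x y -> y \in (C :^ g)^#.
Proof.
move=> frobG cond Gg Cx Gy1 adj; have [nty Gy] := setD1P Gy1.
have [defG _ _ _ _] := Frobenius_context frobG.
have [/andP[sKG nKG] sCG _ nKC tiKC] := sdprod_context defG.
have [ntx Cx'] := setD1P Cx.
have Gx : x \in G.
  by apply: subsetP Cx'; rewrite -(conjGid Gg) conjSg.
have Gx1 : x \in G^# by rewrite !inE ntx.
have nKy : y \notin K.
  apply/negP => Ky; have Ky1 : y \in K^# by rewrite !inE nty.
  have adj' : nadj y x by rewrite /nadj eq_sym orbC.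
  have /setD1P[_ Kx] := frobenius_kernel_closed frobG cond Ky1 Gx1 adj'.
  case/eqP: ntx; apply/set1gP; rewrite -(conjs1g g) -tiKC conjIg inE Cx' andbT.
  by rewrite (normP (subsetP nKG g Gg)).
(* If [x] normalises [<[y]>], then [x] lies in the conjugate of [C] containing [y]; it lies in
   [C :^ g] as well, so the two conjugates coincide. *)
rewrite !inE nty /=; case/andP: adj => _; rewrite !cycle_subG => /orP[nxy|nyx].
  have [h Gh Cy] := frobenius_cover frobG Gy nKy.
  have Cxh := frobenius_compl_normed frobG Gh Cy Gx nxy.
  have /andP[_ /normedTI_memJ_P[_ _ memJ]] := FrobeniusWcompl frobG.
  have Cxh1 : x ^ h^-1 \in C^# by rewrite !inE conjg_eq1 ntx -mem_conjg.
  have Chg : h * g^-1 \in C.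
    rewrite -(memJ _ _ Cxh1) ?groupM ?groupV // -conjgM mulKg.
    by rewrite !inE conjg_eq1 ntx -mem_conjg.
  have [_ Cy'] := setD1P Cy.
  have -> : (C :^ g = C :^ h)%g; last exact: Cy'.
  by rewrite -[in RHS](mulgKV g h) conjsgM (conjGid Chg).
exact: (frobenius_compl_normed frobG Gg Cx Gy nyx).
Qed.

Lemma nwalk_closed (gT : finGroupType) (G : {group gT}) (S : {set gT}) (x y : gT) :
  (forall z t, z \in S -> t \in G^# -> nadj z t -> t \in S) ->
  x \in S -> nconnected_pair G x y -> y \in S.
Proof.
move=> clS Sx [n [p [_ pxp Gp <- _]]] {n y}.
elim: p x Sx pxp Gp => //= z p IHp x Sx /andP[xz zp] /andP[Gz Gp].
by apply: IHp => //; apply: clS xz.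
Qed.

(** [K^#] and the sets [(C :^ g)^#] are closed under adjacency. In [K^#] a central element of [K] is
    adjacent or equal to every vertex; in [(C :^ g)^#] the element [t ^ g] is, for [<[t]>] normal in
    [C]. *)
Theorem frobenius_components (gT : finGroupType) (G K C : {group gT}) :
  solvable G -> [Frobenius G = K ><| C] ->
  (forall p r : nat, prime p -> (p %| #|C|)%N -> prime r ->
     (r %| #|K|)%N -> ~~ (p %| r.-1)%N) ->
  ~ nconnected G /\ (forall x y, nconnected_pair G x y -> ndist_le G x y 2).
Proof.
move=> solG frobG cond.
have [defG ntK ntC _ _] := Frobenius_context frobG.
have [/andP[sKG nKG] sCG _ nKC tiKC] := sdprod_context defG.
have clK x y : x \in K^# -> nconnected_pair G x y -> y \in K^#.
  apply: nwalk_closed => z t; exact: frobenius_kernel_closed frobG cond.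
split=> [conn | x y conn].
  have [k Kk ntk] := trivgPn _ ntK; have [c Cc ntc] := trivgPn _ ntC.
  have /setD1P[_ Kc] : c \in K^#.
    apply: (clK k); first by rewrite !inE ntk.
    by apply: conn; rewrite !inE ?ntk ?ntc /=; [apply: (subsetP sKG) | apply: (subsetP sCG)].
  by case/eqP: ntc; apply/set1gP; rewrite -tiKC inE Kc.
have Gx : x \in G^# by case: conn => n [p []].
have [ntx Gx'] := setD1P Gx.
have hub z : z \in G^# -> x \in 'N(<[z]>) -> y \in 'N(<[z]>) -> y \in G^# ->
    ndist_le G x y 2.
  move=> Gz nxz nyz Gy; apply: (@ndist_trans _ _ _ z _ 1 1).
    exact: ndist_step.
  by apply: ndist_sym; apply: ndist_step.
have [Kx | nKx] := boolP (x \in K).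
  have Kx1 : x \in K^# by rewrite !inE ntx.
  have /setD1P[nty Ky] := clK x y Kx1 conn.
  have [z /setD1P[ntz Kz] cKz] := frobenius_kernel_centre solG frobG.
  apply: (hub z).
  - by rewrite !inE ntz (subsetP sKG).
  - exact/cent1_norm_cycle/(subsetP cKz).
  - exact/cent1_norm_cycle/(subsetP cKz).
  - by rewrite !inE nty (subsetP sKG).
have [g Gg Cx] := frobenius_cover frobG Gx' nKx.
have /setD1P[nty Cy] : y \in (C :^ g)^#.
  apply: nwalk_closed Cx conn => z t; exact: frobenius_compl_closed frobG cond Gg.
have sCgG : C :^ g \subset G by rewrite -(conjGid Gg) conjSg.
have [t /setD1P[ntt Ct] nCt] := frobenius_compl_normal_cycle solG frobG.
have nCtg : C :^ g \subset 'N(<[t ^ g]>) by rewrite cycleJ normJ conjSg.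
have [_ Cx'] := setD1P Cx.
have Gt : t ^ g \in G^#.
  by rewrite !inE conjg_eq1 ntt groupJ // (subsetP sCG).
have Gy : y \in G^# by rewrite !inE nty (subsetP sCgG).
by apply: (hub (t ^ g)) => //; apply: (subsetP nCtg).
Qed.

(** * A criterion for distance 6 *)

(** The automorphism group of the cyclic group [W] has order [totient #|W|]. *)
Lemma coprime_totient_cent_cyclic (gT : finGroupType) (W : {group gT}) (m : gT) :
  cyclic W -> m \in 'N(W) -> coprime #[m] (totient #|W|) -> m \in 'C(W).
Proof.
move=> cycW nWm co; rewrite -ker_conj_aut; apply/kerP => //.
apply/eqP; rewrite -order_eq1 -dvdn1 -(eqP co) dvdn_gcd.
rewrite morph_order //= -card_Aut_cyclic // order_dvdG //.
by apply: (subsetP (Aut_conj_aut W 'N(W))); rewrite mem_morphim.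
Qed.

(** Walks shorter than the bound are padded: [z] may equal [x], which is why distinctness is
    dropped. *)
Lemma ndist_succ (gT : finGroupType) (G : {group gT}) (x y : gT) (n : nat) :
  ndist_le G x y n.+1 ->
  exists z, [/\ z \in G^#, x \in 'N(<[z]>) \/ z \in 'N(<[x]>) & ndist_le G z y n].
Proof.
case=> m mn [[|z p] [Gx pxp Gp py sp]].
  exists x; split=> //; first by left; rewrite (subsetP (normG _)) ?cycle_id.
  by exists 0%N => //; exists [::].
move: pxp Gp py sp => /= /andP[/andP[_ xz] zp] /andP[Gz Gp] py sp.
exists z; split=> //; first by rewrite !cycle_subG in xz; apply/orP.
exists (size p); first by rewrite -ltnS sp.
by exists p.
Qed.

Section Distance.

Variables (gT : finGroupType) (G H : {group gT}) (r p : nat) (n k : gT).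
Hypotheses (pr : prime r) (pp : prime p) (neq_rp : r != p).
Hypotheses (p_r1 : ~~ (p %| r.-1)%N) (rH : r.-group H).
Hypotheses (on : #[n] = (p ^ 2)%N) (defG : H ><| <[n]> = G).
Hypotheses (Hk : k \in H) (cHn : 'C_H[n] = 1).

Let y := n ^+ p.
Let A := 'C_H[y].
Hypothesis ntA : A != 1.
Hypothesis nocomm : forall a b, a \in A^# -> b \in A^# -> b ^ k \notin 'C[a].

Let nsHG : H <| G. Proof. by have [] := sdprod_context defG. Qed.
Let sHG : H \subset G := normal_sub nsHG.
Let nHG : G \subset 'N(H) := normal_norm nsHG.
Let sNG : <[n]> \subset G. Proof. by have [] := sdprod_context defG. Qed.
Let tiHN : H :&: <[n]> = 1. Proof. by have [] := sdprod_context defG. Qed.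

Let commH : [~: G, G] \subset H.
Proof.
rewrite -quotient_cents2 //; have [_ <- _ _] := sdprodP defG.
by rewrite quotientMidl; apply: quotient_abelian; apply: cycle_abelian.
Qed.

Let prG s : prime s -> (s %| #|G|)%N -> s = r \/ s = p.
Proof.
move=> ps; rewrite -(sdprod_card defG) -orderE on Euclid_dvdM // => /orP[sH|].
  by left; apply/eqP; apply: (pgroupP rH).
by rewrite Euclid_dvdX // dvdn_prime2 // => /andP[/eqP-> _]; right.
Qed.

Let co_rp : coprime r p.
Proof. by rewrite prime_coprime // dvdn_prime2. Qed.

(** If [d] lies in [H], then [<[d]>] has [r - 1] automorphisms, a number prime to both [r] and [p].
    Otherwise the commutator of [c] and [d] lies in [<[d]>] and [H], which meet trivially. *)
Lemma prime_norm_comm c d :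
  c \in G -> d \in G -> prime #[c] -> prime #[d] -> c \in 'N(<[d]>) -> c \in 'C[d].
Proof.
move=> Gc Gd pc pd ncd; have [Hd | nHd] := boolP (d \in H).
  have od : #[d] = r.
    apply/eqP; rewrite -[_ == _]/(#[d] \in (r : nat_pred)).
    by apply: (pgroupP rH) => //; apply: order_dvdG.
  rewrite -cent_cycle; apply: coprime_totient_cent_cyclic => //.
    exact: cycle_cyclic.
  rewrite -orderE od totient_prime //.
  have [->|->] := prG pc (order_dvdG Gc).
    rewrite prime_coprime //; apply/negP => /dvdn_leq.
    by have := prime_gt1 pr; case: (r) => [|[|s]] // _ /(_ isT); rewrite ltnn.
  by rewrite prime_coprime.
have ti : <[d]> :&: H = 1.
  by apply: prime_TIg; rewrite -?orderE ?cycle_subG.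
apply/cent1P/esym/commgP/eqP/set1gP; rewrite -ti inE.
rewrite [X in _ && X](subsetP commH) ?mem_commg // andbT.
by rewrite commgEl groupM ?groupV ?memJ_norm ?cycle_id.
Qed.

(** If [u] normalises [<[m]>], their commutator lies in both [H] and [<[n]>]. If [m] normalises
    [<[u]>], then [m] centralises the cyclic [r]-group [W]; so [u ^ (m ^+ i) = u * w ^+ i], and [w]
    has order dividing that of [m] as well as a power of [r]. *)
Lemma complement_norm_comm m u :
  m \in <[n]> -> u \in G ->
  m \in 'N(<[u]>) \/ u \in 'N(<[m]>) -> u \in 'C_G[m].
Proof.
move=> Nm Gu nor; apply/setIP; split=> //; have Gm := subsetP sNG m Nm.
have comm_mu : [~ m, u] \in H by rewrite (subsetP commH) // mem_commg.
case: nor => [nm | nu]; last first.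
  apply/cent1P/esym/commgP/eqP/set1gP; rewrite -tiHN inE comm_mu /=.
  rewrite commgEl groupM ?groupV //.
  have: m ^ u \in <[m]> by rewrite memJ_norm ?cycle_id.
  by apply: subsetP; rewrite cycle_subG.
pose W := (<[u]> :&: H)%G; pose w := [~ u, m].
have Ww : w \in W.
  rewrite inE (subsetP commH) ?mem_commg // andbT.
  by rewrite /w commgEl groupM ?groupV ?memJ_norm ?cycle_id.
have rW : r.-group W by apply: pgroupS rH; apply: subsetIr.
have com : coprime #|H| #[m].
  apply: (pnat_coprime rH); apply: (pnat_dvd (order_dvdG Nm)).
  by move: neq_rp; rewrite eq_sym -orderE on pnatX pnatE // !inE => ->.
have cWm : m \in 'C(W).
  apply: coprime_totient_cent_cyclic.
  - by apply: cyclicS (subsetIl _ _) (cycle_cyclic u).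
  - by apply/normP; rewrite conjIg (normP nm) (normP (subsetP nHG m Gm)).
  have [e ->] := p_natP rW.
  apply: coprime_dvdl (order_dvdG Nm) _; rewrite -orderE on coprimeXl //.
  case: e => [|e]; first exact: coprimen1.
  by rewrite totient_pfactor // coprimeMr prime_coprime // p_r1 coprimeXr // coprime_sym.
have uX i : u ^ (m ^+ i) = u * w ^+ i.
  elim: i => [|i IHi]; first by rewrite !expg0 conjg1 mulg1.
  rewrite expgSr conjgM IHi conjMg conjXg.
  have -> : w ^ m = w by apply/conjg_fixP/commgP/esym; apply: (centP cWm).
  by rewrite {1}[u ^ m]conjg_mulR -/w -mulgA -expgS.
have w1 : w ^+ #[m] = 1.
  by apply: (mulgI u); rewrite -uX expg_order conjg1 mulg1.
apply/cent1P/commgP; rewrite -/w -order_eq1 -dvdn1.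
have : coprime #[w] #[m].
  by apply: coprime_dvdl com; apply: order_dvdG; case/setIP: Ww.
by move/eqP <-; rewrite dvdn_gcd dvdnn order_dvdn w1 /=.
Qed.

Let Nn : n \in <[n]> := cycle_id n.
Let Gn : n \in G := subsetP sNG n Nn.
Let Gk : k \in G := subsetP sHG k Hk.
Let Ny : y \in <[n]> := mem_cycle n p.
Let oy : #[y] = p.
Proof. by rewrite orderXdiv on expnS expn1 ?mulnK ?prime_gt0 ?dvdn_mulr. Qed.

Let p'H : p^'.-nat #|H|.
Proof.
apply: pi_pnat rH _; by rewrite !inE.
Qed.

Let cyclic_pgroup (E : {group gT}) : p.-group E -> E \subset G -> cyclic E.
Proof.
move=> pE sEG.
have sylN : p.-Sylow(G) <[n]>.
  rewrite pHallE sNG -(sdprod_card defG) partnM // (part_p'nat p'H) mul1n.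
  by rewrite -orderE on part_pnat_id /= ?eqxx // pnatX pnat_id.
have [g _ sE] := Sylow_subJ sylN sEG pE.
by apply: cyclicS sE _; rewrite cyclicJ cycle_cyclic.
Qed.

Let prime_elt_p c : c \in G -> prime #[c] -> c \notin H -> #[c] = p.
Proof.
move=> Gc pc nHc; have [oc|//] := prG pc (order_dvdG Gc).
case/negP: nHc; rewrite -cycle_subG.
have sylH : r.-Sylow(G) H.
  rewrite /pHall sHG rH /= -divgS // -(sdprod_card defG) mulKn ?cardG_gt0 //.
  by move: neq_rp; rewrite eq_sym -orderE on pnatX pnatE // !inE => ->.
by rewrite (sub_normal_Hall sylH) ?cycle_subG // /pgroup -orderE oc pnat_id.
Qed.

(** [c] and [y] generate a [p]-group, which is cyclic and so has a single subgroup of order [p]. *)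
Let cent_y_order_p c : c \in 'C_G[y] -> #[c] = p -> <[c]> = <[y]>.
Proof.
case/setIP=> Gc yc oc.
have cyc : <[y]> \subset 'C(<[c]>) by rewrite cent_cycle cycle_subG cent1C.
have cycE : cyclic (<[c]> <*> <[y]>).
  apply: cyclic_pgroup; last by rewrite join_subG !cycle_subG Gc groupX.
  by rewrite /= cent_joinEr // pgroupM /pgroup -!orderE oc oy pnat_id.
apply/eqP; rewrite (eq_subG_cyclic cycE) ?joing_subl ?joing_subr //.
by rewrite -!orderE oc oy.
Qed.

Let cent_y_cases c : c \in 'C_G[y] -> prime #[c] -> c \in A^# \/ <[c]> = <[y]>.
Proof.
move=> yc pc; have [Hc | nHc] := boolP (c \in H).
  by left; rewrite in_setD1 prime_order_neq1 // inE Hc; case/setIP: yc.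
by right; apply: cent_y_order_p => //; apply: prime_elt_p => //; case/setIP: yc.
Qed.

Let AJ a : a \in 'C_H[y ^ k] -> exists2 b, b \in A & a = b ^ k.
Proof.
case/setIP=> Ha ya; exists (a ^ k^-1); last by rewrite conjgKV.
by rewrite inE groupJ ?groupV // -mem_conjg -cent1J.
Qed.

(** Each of [c] and [d] lies in [A^#] or generates [<[y]>]. When at least one generates [<[y]>],
    commutation puts a nontrivial element in both [A] and [A :^ k]; it commutes with itself, against
    [nocomm]. *)
Lemma cent_y_conj_noncomm c d :
  c \in 'C_G[y] -> d \in 'C_G[y] -> prime #[c] -> prime #[d] -> c \notin 'C[d ^ k].
Proof.
move=> yc yd pc pd; apply/negP => cd.
have ntc := prime_order_neq1 pc; have ntd := prime_order_neq1 pd.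
have [Ac | Dc] := cent_y_cases yc pc; have [Ad | Dd] := cent_y_cases yd pd.
- by case/negP: (nocomm Ac Ad); rewrite cent1C.
- have [_ /setIP[Hc _]] := setD1P Ac.
  have [|b Ab Db] := @AJ c.
    by rewrite inE Hc -cent_cycle cycleJ -Dd -cycleJ cent_cycle.
  have Ab1 : b \in A^# by rewrite in_setD1 Ab andbT -(conjg_eq1 b k) -Db.
  by case/negP: (nocomm Ac Ab1); rewrite -Db cent1id.
- have [_ /setIP[Hd _]] := setD1P Ad.
  have Adk : d ^ k \in A^#.
    rewrite in_setD1 conjg_eq1 ntd inE groupJ //= -cent_cycle -Dc cent_cycle.
    by rewrite cent1C.
  by case/negP: (nocomm Adk Ad); rewrite cent1id.
have yky : y ^ k \in 'C_G[y].
  rewrite inE groupJ ?(subsetP sNG y) //= -cent_cycle -Dc cent_cycle cent1C.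
  rewrite -cent_cycle in cd; move: cd; rewrite cycleJ Dd -cycleJ cent_cycle.
  by [].
have Dyk : <[y ^ k]> = <[y]> by apply: cent_y_order_p; rewrite ?orderJ.
have [a Aa nta] := trivgPn _ ntA.
have [|b Ab Db] := @AJ a.
  by rewrite inE -cent_cycle Dyk cent_cycle; move: Aa; rewrite inE.
have Aa1 : a \in A^# by rewrite in_setD1 nta.
have Ab1 : b \in A^# by rewrite in_setD1 Ab andbT -(conjg_eq1 b k) -Db.
by case/negP: (nocomm Aa1 Ab1); rewrite -Db cent1id.
Qed.

(** Every nontrivial subgroup of the cyclic group [<[n]>] of order [p ^ 2] contains [y]. *)
Let cent_y m : m \in <[n]> -> m != 1 -> 'C_G[m] \subset 'C_G[y].
Proof.
move=> Nm ntm; rewrite setIS // -!cent_cycle centS //.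
rewrite -(cardSg_cyclic (cycle_cyclic n)) ?cycle_subG // -!orderE oy.
have := order_dvdG Nm; rewrite -orderE on => /dvdn_pfactor[]// i _ Dm.
rewrite Dm; case: i Dm => [|i] Dm; last by rewrite expnS dvdn_mulr.
by rewrite -order_eq1 Dm in ntm.
Qed.

(** A neighbour of [n] centralises [n], hence lies in [<[n]>] because [n] is regular on [H]; its own
    neighbours then centralise [y]. *)
Lemma two_steps_cent u v :
  u \in G^# -> v \in G ->
  n \in 'N(<[u]>) \/ u \in 'N(<[n]>) -> u \in 'N(<[v]>) \/ v \in 'N(<[u]>) ->
  v \in 'C_G[y].
Proof.
move=> /setD1P[ntu Gu] Gv nu uv.
have Nu : u \in <[n]>.
  apply: (subsetP (sdprod_cent1_compl defG Nn cHn)).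
  exact: complement_norm_comm.
by apply: (subsetP (cent_y Nu ntu)); apply: complement_norm_comm.
Qed.

Lemma conj_ndist_gt5 : ~ ndist_le G n (n ^ k) 5.
Proof.
(* In a padded walk from [n] to [n ^ k], [x2] centralises [y] and [x3] centralises [y ^ k]; suitable
   powers of prime order of these neighbours would commute. *)
case/ndist_succ=> x1 [Gx1 n1 /ndist_succ[x2 [Gx2 n2]]].
case/ndist_succ=> x3 [Gx3 n3 /ndist_succ[x4 [Gx4 n4]]].
case/ndist_succ=> x5 [Gx5 n5 [m]]; rewrite leqn0 => /eqP->.
move=> [s [_ _ _ Dx5 sz]]; have Ds := size0nil sz.
rewrite {}Ds /= in Dx5.
have yx2 : x2 \in 'C_G[y].
  by apply: two_steps_cent n1 n2 => //; case/setD1P: Gx2.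
have GkV : k^-1 \in G by rewrite groupV.
have NJ (g u v : gT) : u \in 'N(<[v]>) -> u ^ g \in 'N(<[v ^ g]>).
  by rewrite cycleJ normJ memJ_conjg.
have yx3 : x3 ^ k^-1 \in 'C_G[y].
  apply: (@two_steps_cent (x4 ^ k^-1)) => //.
  - by have [nt4 G4] := setD1P Gx4; rewrite in_setD1 conjg_eq1 nt4 groupJ.
  - by rewrite groupJ //; case/setD1P: Gx3.
  - by case: n5 => /(NJ k^-1); rewrite Dx5 conjgK => ?; [right | left].
  by case: n4 => /(NJ k^-1) ?; [right | left].
have [[nt2 G2] [nt3 G3]] := (setD1P Gx2, setD1P Gx3).
have [c cx2 pc] := ex_prime_power nt2; have [d dx3 pd] := ex_prime_power nt3.
have sub_cent (z t : gT) : z \in 'C_G[y] -> t \in <[z]> -> t \in 'C_G[y].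
  by rewrite -!cycle_subG => s1 s2; apply: subset_trans s2 s1.
have yc := sub_cent _ _ yx2 cx2.
have yd : d ^ k^-1 \in 'C_G[y].
  by apply: sub_cent yx3 _; rewrite cycleJ memJ_conjg.
have pdk : prime #[d ^ k^-1] by rewrite orderJ.
have cd : c \in 'C[d].
  have [[Gc _] [Gdk _]] := (setIP yc, setIP yd).
  have Gd : d \in G by rewrite -(conjgKV k d) groupJ.
  have char (z t : gT) : z \in <[t]> -> 'N(<[t]>) \subset 'N(<[z]>).
    move=> tz; rewrite char_norms // sub_cyclic_char ?cycle_cyclic //.
    by rewrite cycle_subG.
  have step (z t z' t' : gT) : z' \in <[z]> -> t' \in <[t]> -> z \in 'N(<[t]>) ->
      z' \in 'N(<[t']>).
    move=> zz tt nzt; apply: (subsetP (char _ _ tt)).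
    by apply: (subsetP _ _ zz); rewrite cycle_subG.
  case: n3 => [n3|n3].
    by apply: prime_norm_comm => //; apply: step n3.
  by rewrite cent1C; apply: prime_norm_comm => //; apply: step n3.
case/negP: (cent_y_conj_noncomm yc yd pc pdk).
by rewrite conjgKV.
Qed.

End Distance.

(** * A group of diameter 6 *)

(* [Tri c a u v w] is the product of c, a and (u, v, w) in F^3 ><| F ><| F^*,
   where a acts on F^3 by (u, v, w) |-> (u, v + a u, w + 2 a v + a^2 u) and c
   acts on F by l = c^11 and on F^3 by (c, l c, l^2 c). *)
Record tri (F : finFieldType) := Tri { tc : {unit F}; ta : F; t1 : F; t2 : F; t3 : F }.

Section TriGroup.

Variable F : finFieldType.
Local Notation T := (tri F).
Local Open Scope ring_scope.

Definition tri_tuple (x : T) := (tc x, (ta x, (t1 x, (t2 x, t3 x)))).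
Definition tuple_tri (y : {unit F} * (F * (F * (F * F)))) : T :=
  let: (c, (a, (u, (v, w)))) := y in Tri c a u v w.

Lemma tri_tupleK : cancel tri_tuple tuple_tri. Proof. by case. Qed.

HB.instance Definition _ := Finite.copy T (can_type tri_tupleK).

(** For [c] of order [11 ^ 2], the exponent 11 makes [c ^+ 11] act trivially on the [ta] coordinate
    while [c] does not. *)
Let lam (c : {unit F}) : F := val c ^+ 11.

Definition tri_mul (x y : T) : T :=
  let d := val (tc y) in let l := lam (tc y) in let b := ta y in
  Tri (tc x * tc y)%g (l * ta x + b) (d * t1 x + t1 y)
    (l * d * t2 x + b * d * t1 x + t2 y)
    (l ^+ 2 * d * t3 x + 2%:R * b * l * d * t2 x + b ^+ 2 * d * t1 x + t3 y).

Definition tri_one : T := Tri 1%g 0 0 0 0.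

Definition tri_inv (x : T) : T :=
  let d := (val (tc x))^-1 in let l := d ^+ 11 in let a := ta x in
  Tri (tc x)^-1%g (- l * a) (- d * t1 x) (l * d * (a * t1 x - t2 x))
    (l ^+ 2 * d * (2%:R * a * t2 x - a ^+ 2 * t1 x - t3 x)).

Lemma tri_mulA : associative tri_mul.
Proof.
case=> [c a u v w] [c' a' u' v' w'] [c'' a'' u'' v'' w''].
by rewrite /tri_mul /lam /=; congr Tri; rewrite ?mulgA //; ring.
Qed.

Lemma tri_mul1 : left_id tri_one tri_mul.
Proof. by case=> c a u v w; rewrite /tri_mul /lam /= mul1g; congr Tri; ring. Qed.

Lemma tri_mulV : left_inverse tri_one tri_inv tri_mul.
Proof.
case=> c a u v w; have nz : val c != 0 :> F by rewrite -unitfE; apply: valP.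
by rewrite /tri_mul /lam /tri_one /= mulVg; congr Tri; field.
Qed.

HB.instance Definition _ := Finite_isGroup.Build T tri_mulA tri_mul1 tri_mulV.

End TriGroup.


(** * The example over the field of order [3 ^ 5] *)

Section TriExample.

Variables (F : finFieldType) (z : {unit F}).
Hypotheses (charF : (3%:R = 0 :> F)%R) (cardF : #|F| = (3 ^ 5)%N).
Hypothesis oz : #[z] = (11 ^ 2)%N.

Local Notation T := (tri F).

Lemma tri_mulE (x y : T) :
  x * y = Tri (tc x * tc y)%g (val (tc y) ^+ 11 * ta x + ta y)%R
    (val (tc y) * t1 x + t1 y)%R
    (val (tc y) ^+ 11 * val (tc y) * t2 x + ta y * val (tc y) * t1 x + t2 y)%R
    ((val (tc y) ^+ 11) ^+ 2 * val (tc y) * t3 x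
      + 2%:R * ta y * val (tc y) ^+ 11 * val (tc y) * t2 x
      + ta y ^+ 2 * val (tc y) * t1 x + t3 y)%R.
Proof. by []. Qed.

Lemma tcM : {in [set: T] &, {morph (@tc F) : x y / x * y >-> x * y}}.
Proof. by []. Qed.

Canonical tc_morphism := Morphism tcM.

Definition triH := 'ker tc_morphism.
Definition trin : T := Tri z 0%R 0%R 0%R 0%R.
Definition trik : T := Tri 1%g 0%R 1%R 0%R 0%R.
Definition triG := (triH <*> <[trin]>)%G.

Lemma triHP (x : T) : reflect (tc x = 1) (x \in triH).
Proof. by apply: (iffP (kerP _ (in_setT x))). Qed.

Lemma trinX i : trin ^+ i = Tri (z ^+ i) 0%R 0%R 0%R 0%R.
Proof.
elim: i => [|i IHi] //; rewrite expgS IHi tri_mulE /= -expgS.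
by congr Tri; ring.
Qed.

Lemma order_trin : #[trin] = (11 ^ 2)%N.
Proof.
apply/eqP; rewrite -oz eqn_dvd !order_dvdn trinX expg_order eqxx /=.
by have := expg_order trin; rewrite trinX => /(congr1 (@tc F)) /= ->.
Qed.

Lemma unit_valX i : val (z ^+ i) = (val z ^+ i)%R :> F.
Proof. by elim: i => [|i IHi] //; rewrite expgS exprS -IHi. Qed.

Lemma zX_neq1 i : ~~ (11 ^ 2 %| i)%N -> (val z ^+ i != 1 :> F)%R.
Proof.
apply: contra => /eqP zi; rewrite -oz order_dvdn; apply/eqP/val_inj.
by rewrite /= unit_valX zi.
Qed.

Lemma fix0 (c x : F) : (c != 1)%R -> x = (c * x)%R -> x = 0%R.
Proof.
move=> c1 E; have : ((c - 1) * x = 0)%R by rewrite mulrBl -E mul1r subrr.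
by move/eqP; rewrite mulf_eq0 subr_eq0 (negPf c1) => /eqP.
Qed.

(** The factors 11, 1, 12 and 23 are the weights of [z] on the four coordinates. None is divisible
    by [11 ^ 2]; after multiplication by 11 only the first becomes so. *)
Lemma tri_commute_trinX i x :
  x \in triH -> commute x (trin ^+ i) ->
  [/\ ta x = val z ^+ (i * 11) * ta x, t1 x = val z ^+ i * t1 x,
      t2 x = val z ^+ (i * 12) * t2 x & t3 x = val z ^+ (i * 23) * t3 x]%R.
Proof.
case: x => c a u v w /triHP /= ->; rewrite trinX /commute !tri_mulE /=.
rewrite unit_valX !(expr0n, mulr0, mul0r, add0r, addr0) => -[_ Ea Eu Ev Ew].
split; [rewrite -{1}Ea | rewrite -{1}Eu | rewrite -{1}Ev | rewrite -{1}Ew].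
- by rewrite exprM.
- by [].
- by rewrite (mulnS i 11) exprD exprM [(val z ^+ i * _)%R]mulrC.
by rewrite (mulnS i 22) exprD -[22%N]/(11 * 2)%N mulnA !exprM [(val z ^+ i * _)%R]mulrC.
Qed.

Lemma triH_sdprod : triH ><| <[trin]> = triG.
Proof.
rewrite sdprodEY //; first by rewrite cycle_subG (subsetP (ker_norm _)) ?inE.
apply/trivgP/subsetP => x /setIP[/triHP Hx /cycleP[i Dx]].
by rewrite inE Dx trinX; move: Hx; rewrite Dx trinX /= => ->.
Qed.

Lemma card_triH : #|triH| = (3 ^ 20)%N.
Proof.
pose f (y : F * F * F * F) := let: (a, u, v, w) := y in Tri 1%g a u v w.
have inj_f : injective f by move=> [[[a u] v] w] [[[a' u'] v'] w'] [-> -> -> ->].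
have -> : triH = f @: [set: F * F * F * F] :> {set T}.
  apply/setP => -[c a u v w]; apply/triHP/imsetP => /= [->|[[[[a' u'] v'] w'] _ []]] //.
  by exists (a, u, v, w); rewrite ?inE.
rewrite card_imset // cardsT !card_prod cardF.
by rewrite -!expnD.
Qed.

Lemma solvable_triG : solvable triG.
Proof.
have defG := triH_sdprod; have [nsHG _ _ _ _] := sdprod_context defG.
have pH : 3.-group triH by rewrite /pgroup card_triH pnatX.
rewrite (series_sol nsHG) (nilpotent_sol (pgroup_nil pH)) /=.
have [_ <- _ _] := sdprodP defG.
by rewrite quotientMidl quotient_sol // abelian_sol // cycle_abelian.
Qed.

Lemma cent_trin : 'C_triH[trin] = 1.
Proof.
apply/trivgP/subsetP => x /setIP[Hx /cent1P cx]; rewrite inE.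
have := @tri_commute_trinX 1 x Hx cx; rewrite !mul1n.
case: x Hx {cx} => c a u v w /triHP /= -> [Ea Eu Ev Ew].
rewrite (fix0 _ Ea) ?zX_neq1 // (fix0 _ Eu) ?zX_neq1 //.
by rewrite (fix0 _ Ev) ?zX_neq1 // (fix0 _ Ew) ?zX_neq1.
Qed.

Lemma cent_trin11 x : x \in 'C_triH[trin ^+ 11] -> x = Tri 1%g (ta x) 0%R 0%R 0%R.
Proof.
case/setIP=> Hx /cent1P cx; have := tri_commute_trinX Hx cx.
case: x Hx {cx} => c a u v w /triHP /= -> [_ Eu Ev Ew].
rewrite (fix0 _ Eu) ?zX_neq1 //.
by rewrite (fix0 _ Ev) ?zX_neq1 // (fix0 _ Ew) ?zX_neq1.
Qed.

Definition tria : T := Tri 1%g 1%R 0%R 0%R 0%R.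
(** The last coordinate is central in [triH], which makes [triv] a common endpoint for all
    vertices. *)
Definition triv : T := Tri 1%g 0%R 0%R 0%R 1%R.

Lemma tria_cent : tria \in ('C_triH[trin ^+ 11])^#.
Proof.
rewrite in_setD1 in_setI; apply/and3P; split.
- by apply/eqP => -[/eqP]; rewrite oner_eq0.
- exact/triHP.
apply/cent1P; rewrite /commute trinX !tri_mulE /= unit_valX.
have /= -> : (val z ^+ 11 ^+ 11 = 1 :> F)%R.
  by rewrite -exprM -unit_valX -[(11 * 11)%N]/(11 ^ 2)%N -oz expg_order.
by rewrite mulg1 mul1g; congr Tri; ring.
Qed.

(** The last coordinates of the two products of [a] and [b ^ trik] differ by [2 * s * t], which is
    nonzero in characteristic 3. *)
Lemma tri_noncomm a b :
  a \in ('C_triH[trin ^+ 11])^# -> b \in ('C_triH[trin ^+ 11])^# ->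
  b ^ trik \notin 'C[a].
Proof.
move=> /setD1P[nta Ca] /setD1P[ntb Cb].
have Da := cent_trin11 Ca; have Db := cent_trin11 Cb.
set s := ta a in Da; set t := ta b in Db.
have nz_s : s != 0%R by apply: contraNneq nta => s0; rewrite Da s0.
have nz_t : t != 0%R by apply: contraNneq ntb => s0; rewrite Db s0.
have -> : b ^ trik = Tri 1%g t 0%R (- t)%R (- t ^+ 2)%R.
  apply: (mulgI trik); rewrite -conjgC Db !tri_mulE /=.
  by rewrite !mulg1; congr Tri; ring.
apply/cent1P; rewrite Da /commute !tri_mulE /=.
rewrite !(expr1n, mul1r, mulr1, mulr0, addr0, add0r) => -[_ E].
have : (s * t = 0)%R.
  transitivity (3%:R * (s * t) + ((- t ^+ 2 + 2%:R * s * - t) + t ^+ 2))%R.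
    by ring.
  by rewrite charF mul0r add0r E addNr.
by move/eqP; rewrite mulf_eq0 (negPf nz_s) (negPf nz_t).
Qed.

Lemma triG_diam : ndiam_eq triG 6.
Proof.
have defG := triH_sdprod; have [nsHG sNG _ _ _] := sdprod_context defG.
have sHG := normal_sub nsHG.
have Gn : trin \in triG by rewrite (subsetP sNG) ?cycle_id.
have Hk : trik \in triH by apply/triHP.
have Gk := subsetP sHG _ Hk.
have ntn : trin != 1 by rewrite -order_gt1 order_trin.
have /setD1P[nta Ca] := tria_cent; have [Ha na] := setIP Ca.
(* Here [trin ^+ 11] is centralised by the complement [<[trin]>] and itself centralises [tria]. *)
have d3 : forall g, g \in triG^# -> ndist_le triG g triv 3.
  apply: (@complement_ndist3 _ _ _ _ (trin ^+ 11) tria triv defG).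
  - rewrite !inE mem_cycle andbT -order_eq1 orderXdiv order_trin //.
  - apply: cents_norm; rewrite cent_cycle cycle_subG.
    exact: cycle_cent1 (mem_cycle _ _).
  - by rewrite in_setD1 nta.
  - by apply: cent1_norm_cycle; rewrite cent1C.
  - rewrite in_setD1; apply/andP; split; last exact/triHP.
    by apply/eqP => -[/eqP]; rewrite oner_eq0.
  apply/subsetP => -[c a u v w] /triHP /= ->.
  apply/cent1P; rewrite /commute !tri_mulE /=.
  by congr Tri; ring.
split=> [x y Gx Gy|].
  by apply: (@ndist_trans _ _ _ triv _ 3 3); [|apply: ndist_sym]; apply: d3.
exists trin, (trin ^ trik); split=> //; split.
- by rewrite !inE ntn.
- by rewrite !inE conjg_eq1 ntn groupJ.
have ntA : 'C_triH[trin ^+ 11] != 1.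
  by apply/trivgPn; exists tria.
have pH : 3.-group triH by rewrite /pgroup card_triH pnatX.
exact: (conj_ndist_gt5 _ _ _ _ pH order_trin defG Hk cent_trin ntA tri_noncomm).
Qed.

End TriExample.

(** * Combination of the dichotomy, the Frobenius case and the example *)

Theorem theorem1 :
  (forall (gT : finGroupType) (G : {group gT}), solvable G ->
     (~ nconnected G <->
        exists K C : {group gT},
          [Frobenius G = K ><| C] /\
          (forall p r : nat, prime p -> (p %| #|C|)%N -> prime r ->
             (r %| #|K|)%N -> ~~ (p %| r.-1)%N))
     /\ (~ nconnected G ->
           forall x y, nconnected_pair G x y -> ndist_le G x y 2)
     /\ (nconnected G -> ndiam_le G 6))
  /\ exists (gT : finGroupType) (G : {group gT}), solvable G /\ ndiam_eq G 6.
Proof.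
split=> [gT G solG|].
  have diam_conn : ndiam_le G 6 -> nconnected G.
    by move=> diam x y Gx Gy; apply: ndist_connected (diam x y Gx Gy).
  (* The alternatives exclude each other: a diameter bound gives connectedness, whereas the
     Frobenius condition gives disconnectedness. *)
  have dich := solvable_frobenius_or_diam6 solG.
  split; last split.
  - split=> [disc | [K [C [frobG cond]]]].
      by case: dich => // /diam_conn.
    by have [] := frobenius_components solG frobG cond.
  - move=> disc; case: dich => [[K [C [frobG cond]]] | /diam_conn //].
    by have [] := frobenius_components solG frobG cond.
  by case: dich => // [[K [C [frobG cond]]]]; have [] := frobenius_components solG frobG cond.
(* 3^5 - 1 = 2 * 11^2, and 11 divides neither 3 nor 3 - 1. *)
have [F charF cardF] := @pPrimePowerField 3 5 isT isT.
have [g Dg] := cyclicP (field_unit_group_cyclic [set: {unit F}]).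
have og : #[g] = 242 by rewrite orderE -Dg card_finField_unit cardF.
have oz : #[g ^+ 2] = (11 ^ 2)%N by rewrite orderXdiv og.
have char3 : (3%:R = 0 :> F)%R by apply/eqP; case/andP: charF.
exists (tri F), (triG (g ^+ 2)); split; first exact: solvable_triG.
exact: triG_diam.
Qed.
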